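(* The rational function $$t=\sum_{i=1}^5\rho^i(T)+\sum_{i=1}^5\kappa\rho^i(T),\qquad T=\frac{x_1x_2x_3x_4}{x_5^4},$$ on Bring's curve $B$ is a generator of the function field $\mathbb{Q}(B/S_5)$ over $\mathbb{Q}$. It gives rise to an algebraic Belyi function over $\mathbb{Q}$: $$B\to\mathbb{P}^1,\qquad [x_1:x_2:x_3:x_4:x_5]\mapsto t.$$
   Context: Bring's curve $B$ is the curve over $\mathbb{Q}$ in $\mathbb{P}^4$, with homogeneous coordinates $[x_1:x_2:x_3:x_4:x_5]$, defined by $\sum_{i=1}^5x_i=\sum_{i=1}^5x_i^2=\sum_{i=1}^5x_i^3=0$. The symmetric group $S_5$ acts on $B$, and hence on its function field $\mathbb{Q}(B)$, by permuting the coordinates; $\rho$ and $\kappa$ are the automorphisms of $B$ corresponding to $(12345)$ and $(12)$ in $S_5$ respectively. $B/S_5$ is the quotient curve and $\mathbb{Q}(B/S_5)$ is its function field. An algebraic Belyi function on $B$ over $\mathbb{Q}$ is a non-constant function $B\to\mathbb{P}^1$ defined over $\mathbb{Q}$ and ramified at most over $\{0,1,\infty\}$.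
   Formalization: Literally, t = 10 + 2e4^5/e5^4 is ramified over 10 (e.g. at (1:ζ:ζ²:ζ³:ζ⁴)), so t itself is not ramified only over {0,1,∞}; the formal statement says that a·t+b is an algebraic Belyi function for some rational a ≠ 0 and b. *)

(* Defs.v *)
From HB Require Import structures.
From mathcomp Require Import all_boot all_order all_algebra all_fingroup all_field.
From mathcomp Require Import boolp.
From mathcomp Require Import mpoly realalg complex ring lra.
Set Implicit Arguments.
Unset Strict Implicit.
Unset Printing Implicit Defensive.
Import Order.TTheory GRing.Theory Num.Theory.
Local Open Scope ring_scope.

Notation Qx := {mpoly rat[5]}.

Definition psum (k : nat) : Qx := \sum_(i < 5) 'X_i ^+ k.

Definition bring_ideal : pred Qx := fun F =>
  `[< exists A : 'I_3 -> Qx, F = \sum_(k < 3) A k * psum k.+1 >].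

(* Primality of the ideal, i.e. irreducibility of B over Q.  Modulo the ideal
   every polynomial is a combination of x_3^i x_4^j (i < 3, j < 2) over
   Q[x_1, x_2], and these monomials are linearly independent over Q at
   infinitely many points of the cone over B with integral x_1, x_2: there x_3
   is a real cubic irrationality and x_4 is not real. *)
Module BringPrime.

Local Notation I := bring_ideal.

Lemma idealP F : reflect (exists a b c, F = a * psum 1 + b * psum 2 + c * psum 3) (F \in I).
Proof.
apply: (iffP (asboolP _)) => [[A ->]|[a [b [c ->]]]].
  do 3 eexists; rewrite !big_ord_recr big_ord0 /= add0r; reflexivity.
exists (fun k : 'I_3 => [tuple a; b; c]`_k).
by rewrite !big_ord_recr big_ord0 /= add0r.
Qed.

Lemma I0 : 0 \in I. Proof. by apply/idealP; exists 0, 0, 0; ring. Qed.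
Lemma ID F G : F \in I -> G \in I -> F + G \in I.
Proof.
move=> /idealP[a [b [c ->]]] /idealP[a' [b' [c' ->]]].
by apply/idealP; exists (a + a'), (b + b'), (c + c'); ring.
Qed.
Lemma IM F G : G \in I -> F * G \in I.
Proof.
move=> /idealP[a [b [c ->]]].
by apply/idealP; exists (F * a), (F * b), (F * c); ring.
Qed.

Local Notation x_ k := ('X_(inord k) : Qx).
Lemma psumE k : psum k = x_ 0 ^+ k + x_ 1 ^+ k + x_ 2 ^+ k + x_ 3 ^+ k + x_ 4 ^+ k.
Proof.
rewrite /psum !big_ord_recr big_ord0 /= add0r.
by do ![congr (_ + _)]; congr ('X_ _ ^+ _); apply/val_inj; rewrite /= inordK.
Qed.

Lemma IZ (n : nat) F : n.+1%:R * F \in I -> F \in I.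
Proof.
move=> h; suff -> : F = (n.+1%:R^-1 : rat)%:MP * (n.+1%:R * F) by apply: IM.
by rewrite mulrA -mpolyC_nat -mpolyCM mulVf ?pnatr_eq0 // mpolyC1 mul1r.
Qed.

Definition h3 (R : comNzRingType) (a b c : R) :=
  c^+3 + c^+2*(a+b) + c*(a^+2+a*b+b^+2) + (a^+3+a^+2*b+a*b^+2+b^+3).
Definition h2 (R : comNzRingType) (a b c d : R) :=
  d^+2 + d*(a+b+c) + (a^+2+b^+2+c^+2+a*b+a*c+b*c).

Lemma I_h1 : x_ 0 + x_ 1 + x_ 2 + x_ 3 + x_ 4 \in I.
Proof. by apply/idealP; exists 1, 0, 0; rewrite !psumE; ring. Qed.
Lemma I_h2 : h2 (x_ 0) (x_ 1) (x_ 2) (x_ 3) \in I.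
Proof.
apply: (@IZ 1); apply/idealP; exists (psum 1 - 2 * x_ 4), 1, 0.
by rewrite /h2 !psumE; ring.
Qed.
Lemma I_h3 : h3 (x_ 0) (x_ 1) (x_ 2) \in I.
Proof.
apply: (@IZ 5); apply/idealP.
exists (psum 1 ^+2 - (x_ 3 + x_ 4) * 3 * psum 1 + 6 * x_ 3 * x_ 4),
  (3 * psum 1 - 3 * (x_ 3 + x_ 4)), 2.
by rewrite /h3 !psumE; ring.
Qed.

Definition phi1 (p : {poly rat}) : Qx := (map_poly (@mpolyC 5 rat) p).[x_ 0].
Definition phi (q : {poly {poly rat}}) : Qx := (map_poly phi1 q).[x_ 1].
Lemma phi1_zmod : zmod_morphism phi1.
Proof. by move=> p q; rewrite /phi1 rmorphB hornerD hornerN. Qed.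
Lemma phi1_mon : monoid_morphism phi1.
Proof. by split=> [|p q]; rewrite /phi1 ?rmorph1 ?hornerE // rmorphM hornerM. Qed.
HB.instance Definition _ := GRing.isZmodMorphism.Build _ _ phi1 phi1_zmod.
HB.instance Definition _ := GRing.isMonoidMorphism.Build _ _ phi1 phi1_mon.
Lemma phi_zmod : zmod_morphism phi.
Proof. by move=> p q; rewrite /phi rmorphB hornerD hornerN. Qed.
Lemma phi_mon : monoid_morphism phi.
Proof. by split=> [|p q]; rewrite /phi ?rmorph1 ?hornerE // rmorphM hornerM. Qed.
HB.instance Definition _ := GRing.isZmodMorphism.Build _ _ phi phi_zmod.
HB.instance Definition _ := GRing.isMonoidMorphism.Build _ _ phi phi_mon.
Lemma phiC c : phi c%:P%:P = c%:MP.
Proof. by rewrite /phi map_polyC hornerC /= /phi1 map_polyC hornerC. Qed.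
Lemma phiX0 : phi 'X%:P = x_ 0.
Proof. by rewrite /phi map_polyC hornerC /= /phi1 map_polyX hornerX. Qed.
Lemma phiX1 : phi 'X = x_ 1.
Proof. by rewrite /phi map_polyX hornerX. Qed.

Definition nf (c : 'I_2 -> 'I_3 -> {poly {poly rat}}) : Qx :=
  \sum_(j < 2) \sum_(i < 3) phi (c j i) * x_ 2 ^+ i * x_ 3 ^+ j.
Definition red F := exists c, F - nf c \in I.

Lemma redI F G : F - G \in I -> red G -> red F.
Proof. by move=> h [c hc]; exists c; rewrite -(subrK G F) -addrA; apply: ID. Qed.
Lemma redD F G : red F -> red G -> red (F + G).
Proof.
move=> [c hc] [d hd]; exists (fun j i => c j i + d j i).
suff -> : F + G - nf (fun j i => c j i + d j i) = (F - nf c) + (G - nf d) by exact: ID.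
suff -> : nf (fun j i => c j i + d j i) = nf c + nf d by ring.
rewrite /nf -big_split /=; apply: eq_bigr => j _.
by rewrite -big_split /=; apply: eq_bigr => i _; rewrite rmorphD; ring.
Qed.
Lemma redM q F : red F -> red (phi q * F).
Proof.
move=> [c hc]; exists (fun j i => q * c j i).
suff -> : phi q * F - nf (fun j i => q * c j i) = phi q * (F - nf c) by exact: IM.
rewrite mulrBr; congr (_ - _); rewrite /nf mulr_sumr; apply: eq_bigr => j _.
by rewrite mulr_sumr; apply: eq_bigr => i _; rewrite rmorphM; ring.
Qed.
Lemma redb (j : 'I_2) (i : 'I_3) : red (x_ 2 ^+ i * x_ 3 ^+ j).
Proof.
exists (fun j' i' => ((j' == j) && (i' == i))%:R).
suff -> : x_ 2 ^+ i * x_ 3 ^+ j = nf (fun j' i' => ((j' == j) && (i' == i))%:R).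
  by rewrite subrr I0.
rewrite /nf (bigD1 j) //= (bigD1 i) //= !eqxx rmorph1 mul1r.
rewrite big1 ?addr0 => [|i' /negPf->]; last by rewrite rmorph0 !mul0r.
rewrite big1 ?addr0 // => j' /negPf-> /=; apply: big1 => i' _.
by rewrite rmorph0 !mul0r.
Qed.
Lemma red_sum (T : Type) (r : seq T) (f : T -> Qx) : (forall t, red (f t)) -> red (\sum_(t <- r) f t).
Proof.
move=> h; elim/big_rec: _ => [|t F _]; last exact: redD.
by rewrite -(mul0r (x_ 2 ^+ (ord0 : 'I_3) * x_ 3 ^+ (ord0 : 'I_2))) -(rmorph0 phi); apply/redM/redb.
Qed.
Lemma red_mul Y : (forall (j : 'I_2) (i : 'I_3), red (Y * (x_ 2 ^+ i * x_ 3 ^+ j))) ->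
  forall F, red F -> red (Y * F).
Proof.
move=> h F [c hc]; apply: (@redI _ (Y * nf c)); first by rewrite -mulrBr IM.
rewrite /nf mulr_sumr; apply: red_sum => j; rewrite mulr_sumr; apply: red_sum => i.
have -> : Y * (phi (c j i) * x_ 2 ^+ i * x_ 3 ^+ j)
  = phi (c j i) * (Y * (x_ 2 ^+ i * x_ 3 ^+ j)) by ring.
exact: redM.
Qed.
Lemma redN F : red F -> red (- F).
Proof. by move=> h; rewrite -mulN1r -(rmorphN1 phi); apply: redM. Qed.
Lemma redB F G : red F -> red G -> red (F - G).
Proof. by move=> hF hG; apply: redD => //; apply: redN. Qed.
Lemma redX0 F : red F -> red (x_ 0 * F).
Proof. by rewrite -phiX0; apply: redM. Qed.
Lemma redX1 F : red F -> red (x_ 1 * F).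
Proof. by rewrite -phiX1; apply: redM. Qed.
Lemma red_2 i (j : 'I_2) : (i < 3)%N -> red (x_ 2 ^+ i * x_ 3 ^+ j).
Proof. by move=> hi; apply: (redb j (Ordinal hi)). Qed.
Local Ltac red_tac h :=
  lazymatch goal with
  | |- red (?a + - ?b) => apply: (@redB a b); red_tac h
  | |- red (- ?a) => apply: (@redN a); red_tac h
  | |- red ('X_(inord 0) * ?a) => apply: (@redX0 a); red_tac h
  | |- red ('X_(inord 1) * ?a) => apply: (@redX1 a); red_tac h
  | _ => apply: h
  end.
Lemma redX2 F : red F -> red (x_ 2 * F).
Proof.
apply: red_mul => j i; rewrite mulrA -exprS.
case: (ltnP i 2) => hi; first exact: red_2.
have -> : nat_of_ord i = 2%N by case: i hi => -[|[|[|]]].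
set w := x_ 3 ^+ j.
have h k : (k < 3)%N -> red (x_ 2 ^+ k * w) by exact: red_2.
apply: (@redI _ (- (x_ 0 * (x_ 2 ^+ 2 * w)) - (x_ 1 * (x_ 2 ^+ 2 * w))
  - (x_ 0 * (x_ 0 * (x_ 2 ^+ 1 * w))) - (x_ 0 * (x_ 1 * (x_ 2 ^+ 1 * w)))
  - (x_ 1 * (x_ 1 * (x_ 2 ^+ 1 * w)))
  - (x_ 0 * (x_ 0 * (x_ 0 * (x_ 2 ^+ 0 * w))))
  - (x_ 0 * (x_ 0 * (x_ 1 * (x_ 2 ^+ 0 * w))))
  - (x_ 0 * (x_ 1 * (x_ 1 * (x_ 2 ^+ 0 * w))))
  - (x_ 1 * (x_ 1 * (x_ 1 * (x_ 2 ^+ 0 * w)))))).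
  have H y : y = w * h3 (x_ 0) (x_ 1) (x_ 2) -> y \in I by move=> ->; apply/IM/I_h3.
  by apply: H; rewrite /h3; ring.
by red_tac h.
Qed.
Local Ltac red_tac3 h :=
  lazymatch goal with
  | |- red (?a + - ?b) => apply: (@redB a b); red_tac3 h
  | |- red (- ?a) => apply: (@redN a); red_tac3 h
  | |- red ('X_(inord 0) * ?a) => apply: (@redX0 a); red_tac3 h
  | |- red ('X_(inord 1) * ?a) => apply: (@redX1 a); red_tac3 h
  | |- red ('X_(inord 2) * ?a) => apply: redX2; red_tac3 h
  | _ => apply: h
  end.
Lemma redX3 F : red F -> red (x_ 3 * F).
Proof.
apply: red_mul => j i.
case: (posnP j) => hj.
  by rewrite hj mulr1 mulrC -(expr1 (x_ 3)); apply: (redb (Ordinal (isT : 1 < 2)%N)).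
have -> : nat_of_ord j = 1%N by case: j hj => -[|[|]].
have h k : (k < 2)%N -> red (x_ 2 ^+ i * x_ 3 ^+ k) by move=> hk; apply: (redb (Ordinal hk)).
set w := x_ 2 ^+ i in h *.
apply: (@redI _ (- (x_ 0 * (w * x_ 3 ^+ 1)) - (x_ 1 * (w * x_ 3 ^+ 1)) - (x_ 2 * (w * x_ 3 ^+ 1))
  - (x_ 0 * (x_ 0 * (w * x_ 3 ^+ 0))) - (x_ 1 * (x_ 1 * (w * x_ 3 ^+ 0)))
  - (x_ 2 * (x_ 2 * (w * x_ 3 ^+ 0))) - (x_ 0 * (x_ 1 * (w * x_ 3 ^+ 0)))
  - (x_ 0 * (x_ 2 * (w * x_ 3 ^+ 0))) - (x_ 1 * (x_ 2 * (w * x_ 3 ^+ 0))))).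
  have H y : y = w * h2 (x_ 0) (x_ 1) (x_ 2) (x_ 3) -> y \in I by move=> ->; apply/IM/I_h2.
  by apply: H; rewrite /h2; ring.
by red_tac3 h.
Qed.
Lemma redX4 F : red F -> red (x_ 4 * F).
Proof.
move=> hF; apply: (@redI _ (- (x_ 0 * F) - x_ 1 * F - x_ 2 * F - x_ 3 * F)).
  have H y : y = F * (x_ 0 + x_ 1 + x_ 2 + x_ 3 + x_ 4) -> y \in I by move=> ->; apply/IM/I_h1.
  by apply: H; ring.
by do ![apply: redB | apply: redN];
  [apply: redX0 | apply: redX1 | apply: redX2 | apply: redX3].
Qed.
Lemma red1 : red 1.
Proof. by have := redb ord0 ord0; rewrite !expr0 mulr1. Qed.
Lemma redX (i : 'I_5) F : red F -> red ('X_i * F).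
Proof.
have -> : i = inord i by apply/val_inj; rewrite /= inordK.
case: i => -[|[|[|[|[|//]]]]] hi /=;
  [exact: redX0 | exact: redX1 | exact: redX2 | exact: redX3 | exact: redX4].
Qed.
Lemma red_all F : red F.
Proof.
rewrite (mpolyE F); apply: red_sum => m.
rewrite -mul_mpolyC -phiC; apply: redM; rewrite mpolyXE_id.
elim/big_rec: _ => [|i G _ hG]; first exact: red1.
by elim: (m i) => [|k IH]; rewrite ?mul1r // exprS -mulrA; apply: redX.
Qed.

Definition gev (n v : nat) (q : {poly {poly rat}}) : rat :=
  (map_poly (horner_eval (n%:R : rat)) q).[v%:R].

Section Evaluation.
Variables (C : numFieldType) (n v : nat) (r s x4 : C).
Hypothesis hr : h3 n%:R v%:R r = 0.
Hypothesis hs : h2 n%:R v%:R r s = 0.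
Hypothesis hx4 : x4 = - (n%:R + v%:R + r + s).
Hypothesis hfree : forall c : 'I_2 -> 'I_3 -> rat,
  \sum_(j < 2) \sum_(i < 3) ratr (c j i) * r ^+ i * s ^+ j = 0 -> forall j i, c j i = 0.

Lemma evaluation : exists e : {rmorphism Qx -> C}, (forall F, F \in I -> e F = 0) /\
  forall c, e (nf c) = 0 -> forall j i, gev n v (c j i) = 0.
Proof.
pose e : {rmorphism Qx -> C} :=
  mmap (ratr : {rmorphism rat -> C}) (tnth [tuple n%:R; v%:R; r; s; x4]).
have eX k : (k < 5)%N -> e 'X_(inord k) = [:: n%:R; v%:R; r; s; x4]`_k.
  by move=> hk; rewrite /e /= mmapX mmap1U (tnth_nth 0) /= inordK.
have eC c : e c%:MP = ratr c by rewrite /e /= mmapC.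
clearbody e.
have e0 := eX 0%N isT; have e1 := eX 1%N isT; have e2 := eX 2%N isT.
have e3 := eX 3%N isT; have e4 := eX 4%N isT.
rewrite /= in e0 e1 e2 e3 e4; clear eX.
have ep1 p : e (phi1 p) = ratr p.[n%:R].
  rewrite /phi1 -horner_map -map_poly_comp e0 -(ratr_nat C) -horner_map.
  by congr _.[_]; apply: eq_map_poly => c; apply: eC.
have ep q : e (phi q) = ratr (gev n v q).
  rewrite /phi /gev -horner_map -map_poly_comp e1 -(ratr_nat C) -horner_map -map_poly_comp.
  by congr _.[_]; apply: eq_map_poly => c; apply: ep1.
exists e; split.
  have pE k : e (psum k) = n%:R ^+ k + v%:R ^+ k + r ^+ k + s ^+ k + x4 ^+ k.
    by rewrite psumE !rmorphD !rmorphXn /= e0 e1 e2 e3 e4.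
  move: pE hr hs hx4; move: (n%:R : C) (v%:R : C) => x0 x1 pE hr' hs' hx4'.
  have p1 : e (psum 1) = 0 by rewrite pE hx4'; ring.
  have p2 : e (psum 2) = 0.
    by rewrite pE hx4'; transitivity (2 * h2 x0 x1 r s); [rewrite /h2; ring | rewrite hs' mulr0].
  have p3 : e (psum 3) = 0.
    rewrite pE hx4'; transitivity (3 * h3 x0 x1 r - 3 * (x0 + x1 + r) * h2 x0 x1 r s); last first.
      by rewrite hs' hr' !mulr0 subrr.
    by rewrite /h2 /h3; ring.
  by move=> F /idealP[a' [b' [c' ->]]]; rewrite !rmorphD !rmorphM /= p1 p2 p3 !mulr0 !addr0.
move=> c h; apply: hfree; rewrite -[RHS]h /nf rmorph_sum; apply: eq_bigr => j _.
rewrite rmorph_sum; apply: eq_bigr => i _.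
by rewrite !rmorphM !rmorphXn /= ep e2 e3.
Qed.
End Evaluation.

Definition cub (K : nzRingType) (a b : K) : {poly K} :=
  Poly [:: a^+3+a^+2*b+a*b^+2+b^+3; a^+2+a*b+b^+2; a + b; 1].

Lemma cubE (K : comNzRingType) (a b c : K) : (cub a b).[c] = h3 a b c.
Proof. by rewrite /cub /h3 horner_Poly /=; ring. Qed.

Lemma polyseq_cub (K : nzRingType) (a b : K) :
  cub a b = [:: a^+3+a^+2*b+a*b^+2+b^+3; a^+2+a*b+b^+2; a + b; 1] :> seq K.
Proof. by rewrite /cub (PolyK (c := 0)) //= oner_neq0. Qed.

Lemma size_cub (K : nzRingType) (a b : K) : size (cub a b) = 4.
Proof. by rewrite polyseq_cub. Qed.

Lemma F3_case (x : 'F_3) : [\/ x = 0, x = 1 | x = 2].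
Proof.
by case: x => -[|[|[|//]]] hx; [apply: Or31 | apply: Or32 | apply: Or33]; apply/val_inj.
Qed.

Lemma h3_scale (K : fieldType) (a q p u : K) : a != 0 -> q != 0 ->
  h3 q (q * u) p = (q / a) ^+ 3 * h3 a (a * u) (a * (p / q)).
Proof. by move=> a0 q0; rewrite /h3; field; rewrite a0 q0. Qed.

Section Point.
Variables (n u : nat).
Hypothesis n_gt0 : (0 < n)%N.
Hypothesis hu : u%:R = 1 :> 'F_3.
Let v := (n * u)%N.
Let a : rat := n%:R.
Let b : rat := v%:R.

Lemma a_neq0 : a != 0.
Proof. by rewrite pnatr_eq0 -lt0n. Qed.

Lemma cub_noroot c : ~~ root (cub a b) c.
Proof.
apply/negP; rewrite /root cubE => /eqP h.
pose p := numq (c / a); pose q := denq (c / a).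
have q0 : q%:~R != 0 :> rat by rewrite intr_eq0 denq_neq0.
have ec : c = a * (p%:~R / q%:~R).
  by rewrite /p /q divq_num_den mulrC divfK ?a_neq0.
have e1 : h3 q (q * u%:Z) p = 0 :> int.
  apply/eqP; rewrite -(intr_eq0 rat); apply/eqP.
  have -> : (h3 q (q * u%:Z) p)%:~R = (q%:~R / a)^+3 * h3 a b c :> rat.
    have bE : b = a * (u%:Z)%:~R by rewrite /b /v natrM.
    rewrite bE ec -h3_scale ?a_neq0 //.
    by rewrite /h3 !(rmorphD, rmorphM, rmorphXn).
  by rewrite h mulr0.
have {e1} e2 : h3 q%:~R q%:~R p%:~R = 0 :> 'F_3.
  have <- : (h3 q (q * u%:Z) p)%:~R = h3 q%:~R q%:~R p%:~R :> 'F_3.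
    have u1 : (u%:Z)%:~R = 1 :> 'F_3 by [].
    by rewrite /h3 !(rmorphD, rmorphM, rmorphXn) /= u1 !mulr1.
  by rewrite e1.
have [p3 q3] : p%:~R = 0 :> 'F_3 /\ q%:~R = 0 :> 'F_3.
  move: e2; rewrite /h3.
  by case: (F3_case p%:~R) => ->; case: (F3_case q%:~R) => -> // /eqP.
have h3F : 3%N \in [pchar 'F_3] by exact: pchar_Fp.
have := coprime_num_den (c / a); rewrite -/p -/q => cpq.
have : (3 %| gcdn `|p| `|q|)%N.
  rewrite dvdn_gcd; apply/andP; split.
    by have := dvdz_pcharf h3F p; rewrite p3 eqxx.
  by have := dvdz_pcharf h3F q; rewrite q3 eqxx.
by rewrite (eqP cpq).
Qed.

Lemma cub_irr : irreducible_poly (cub a b).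
Proof. by apply: cubic_irreducible; [rewrite size_cub | apply: cub_noroot]. Qed.

Let R := realalg.

Lemma cub_root : exists r : R, h3 n%:R v%:R r = 0.
Proof.
pose A : R := n%:R; pose B : R := v%:R.
have A0 : 0 <= A by exact: ler0n.
have B0 : 0 <= B by exact: ler0n.
have [r _ /rootP hr] : exists2 r, - (A + B) <= r <= 0 & root (cub A B) r.
  apply: poly_ivt; rewrite ?oppr_le0 ?addr_ge0 //.
  rewrite !cubE /h3; apply/andP; split; last first.
    have -> : 0 ^+ 3 + 0 ^+ 2 * (A + B) + 0 * (A ^+ 2 + A * B + B ^+ 2) +
      (A ^+ 3 + A ^+ 2 * B + A * B ^+ 2 + B ^+ 3) =
      A ^+ 3 + A ^+ 2 * B + A * B ^+ 2 + B ^+ 3 :> R by ring.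
    by do ![apply: addr_ge0 | apply: mulr_ge0 | apply: exprn_ge0].
  have -> : (- (A + B)) ^+ 3 + (- (A + B)) ^+ 2 * (A + B) + - (A + B) * (A ^+ 2 + A * B + B ^+ 2) +
    (A ^+ 3 + A ^+ 2 * B + A * B ^+ 2 + B ^+ 3) = - (A^+2 * B + A * B ^+2) by ring.
  by rewrite oppr_le0 addr_ge0 ?mulr_ge0 ?exprn_ge0.
by exists r; rewrite -cubE.
Qed.

Lemma cub_free (r : R) (c : 'I_3 -> rat) :
  h3 n%:R v%:R r = 0 -> \sum_(i < 3) ratr (c i) * r ^+ i = 0 -> forall i, c i = 0.
Proof.
move=> hr hc.
pose p := \poly_(i < 3) c (inord i).
have pc (i : 'I_3) : p`_i = c i by rewrite coef_poly ltn_ord inord_val.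
suff p0 : p = 0 by move=> i; rewrite -pc p0 coef0.
apply/eqP; apply: contraTT isT => p0.
have cop : coprimep (cub a b) p.
  rewrite irreducible_poly_coprime; last exact: cub_irr.
  by apply/negP => /(dvdp_leq p0); rewrite size_cub leqNgt ltnS size_poly.
have r1 : root (map_poly (ratr : rat -> R) (cub a b)) r.
  rewrite /root /cub map_Poly horner_Poly /= !(rmorphD, rmorphM, rmorphXn) rmorph1 /=.
  by rewrite !ratr_nat; apply/eqP; apply: etrans hr; rewrite /h3; ring.
have cop' : coprimep (map_poly (ratr : rat -> R) (cub a b)) (map_poly ratr p).
  by rewrite coprimep_map.
have /eqP[] := coprimep_root cop' r1.
rewrite -hc (@horner_coef_wide _ 3) ?size_map_poly ?size_poly //.
by apply: eq_bigr => i _; rewrite coef_map pc.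
Qed.

Let C := complex R.
Let x0 : C := n%:R.
Let x1 : C := v%:R.

Lemma point_exists : exists r s x4 : C, [/\ h3 x0 x1 r = 0, h2 x0 x1 r s = 0,
  x4 = - (x0 + x1 + r + s) &
  forall c : 'I_2 -> 'I_3 -> rat,
    \sum_(j < 2) \sum_(i < 3) ratr (c j i) * r ^+ i * s ^+ j = 0 -> forall j i, c j i = 0].
Proof.
have [r hr] := cub_root.
pose A : R := n%:R; pose B : R := v%:R.
pose D := 2 * (A ^+ 2 + B ^+ 2 + r ^+ 2) + (A + B + r) ^+ 2.
have D0 : 0 < D.
  have : 0 < A ^+ 2 by rewrite exprn_gt0 // ltr0n.
  have := sqr_ge0 B; have := sqr_ge0 r; have := sqr_ge0 (A + B + r).
  by rewrite /D; lra.
pose d := Num.sqrt D.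
have d0 : d != 0 by rewrite lt0r_neq0 // sqrtr_gt0.
have dd : d ^+ 2 = D by rewrite sqr_sqrtr // ltW.
pose rc := real_complex R.
pose s : C := (rc (- (A + B + r)) + 'i%C * rc d) * rc (2^-1).
have hA : rc A = x0 by rewrite /rc /A rmorph_nat.
have hB : rc B = x1 by rewrite /rc /B rmorph_nat.
exists (rc r), s, (- (x0 + x1 + rc r + s)); split=> //.
- rewrite -hA -hB; transitivity (rc (h3 A B r)); last by rewrite hr /rc rmorph0.
  by rewrite /h3 /rc !(rmorphD, rmorphM, rmorphXn).
- have h12 : 2 * rc (2^-1) = 1 :> C.
    by rewrite -(rmorph_nat (real_complex R)) -rmorphM mulfV ?rmorph1 // pnatr_eq0.
  have i2 : ('i%C : C) ^+ 2 = -1 := sqr_i _.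
  have e : (rc d) ^+ 2 = 2 * (x0 ^+ 2 + x1 ^+ 2 + rc r ^+ 2) + (x0 + x1 + rc r) ^+ 2.
    rewrite -rmorphXn dd /D !(rmorphD, rmorphM, rmorphXn) rmorph1 /= -/(rc A) -/(rc B) hA hB; ring.
  have s2 : 2 * s = - (x0 + x1 + rc r) + 'i%C * rc d.
    by rewrite /s mulrC -mulrA [rc _ * 2]mulrC h12 mulr1 -hA -hB /rc rmorphN !rmorphD.
  have : 4 * h2 x0 x1 (rc r) s = 0.
    have -> : 4 * h2 x0 x1 (rc r) s = (2 * s) ^+ 2 + 2 * (2 * s) * (x0 + x1 + rc r)
       + 4 * (x0^+2+x1^+2+rc r^+2+x0*x1+x0*rc r+x1*rc r) by rewrite /h2; ring.
    have sq (S i d' t : C) : S = - t + i * d' ->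
       S ^+ 2 + 2 * S * t = i ^+ 2 * d' ^+ 2 - t ^+ 2 by move=> ->; ring.
    by rewrite (sq _ _ _ _ s2) i2 e; ring.
  by move/eqP; rewrite mulf_eq0 pnatr_eq0 => /eqP.
- move=> c.
  pose S j := \sum_(i < 3) ratr (c j i) * r ^+ i.
  have rS j : \sum_(i < 3) ratr (c j i) * rc r ^+ i = rc (S j).
    rewrite /S /rc rmorph_sum; apply: eq_bigr => i _.
    rewrite rmorphM rmorphXn; congr (_ * _).
    by rewrite -(fmorph_eq_rat (real_complex R \o (ratr : {rmorphism rat -> R}))).
  under eq_bigr do rewrite -mulr_suml rS.
  rewrite !big_ord_recr big_ord0 /= add0r expr0 mulr1 expr1 => h.
  move: h; set S0 := S _; set S1 := S _ => h.
  have es : rc S0 + rc S1 * s =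
      Complex (S0 - S1 * (A + B + r) / 2) (S1 * d / 2).
    rewrite /s /rc; apply/eqP; rewrite eq_complex; apply/andP; split; apply/eqP => /=; ring.
  have [h0 h1] : S0 - S1 * (A + B + r) / 2 = 0 /\ S1 * d / 2 = 0.
    by move: h; rewrite es => -[].
  have S1E : S1 = 0.
    by move/eqP: h1; rewrite !mulf_eq0 (negPf d0) invr_eq0 pnatr_eq0 !orbF => /eqP.
  have S0E : S0 = 0 by move: h0; rewrite S1E !mul0r subr0.
  move=> j i; case: (unliftP ord_max j) => [j'|] ->; last by apply: (cub_free hr S1E).
  rewrite (_ : lift _ _ = widen_ord (leqnSn 1) ord_max); last first.
    by apply/val_inj; rewrite /= /bump; case: j' => -[].
  by apply: (cub_free hr S0E).
Qed.

Lemma specialization : exists (K : numFieldType) (e : {rmorphism Qx -> K}),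
  (forall F, F \in I -> e F = 0) /\
  forall c, e (nf c) = 0 -> forall j i, gev n v (c j i) = 0.
Proof.
have [r [s [x4 [hr hs hx4 hfree]]]] := point_exists.
by exists C; apply: (evaluation hr hs hx4 hfree).
Qed.
End Point.

Lemma poly_many_roots (p : {poly rat}) (f : nat -> rat) : injective f ->
  (forall k, p.[f k] = 0) -> p = 0.
Proof.
move=> fi h; apply: (@roots_geq_poly_eq0 _ p [seq f k | k <- iota 0 (size p)]).
- by apply/allP => x /mapP[k _ ->]; apply/rootP.
- by rewrite map_inj_uniq ?iota_uniq.
- by rewrite size_map size_iota.
Qed.

Lemma grid_eq0 (q : {poly {poly rat}}) :
  (forall n m, gev n.+1 (n.+1 * (3 * m + 1)) q = 0) -> q = 0.
Proof.
move=> h; apply/polyP => k; rewrite coef0.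
apply: (@poly_many_roots _ (fun n => n.+1%:R)); first by move=> x y /eqP; rewrite eqr_nat => /eqP[].
move=> n; have : map_poly (horner_eval (n.+1%:R : rat)) q = 0.
  apply: (@poly_many_roots _ (fun m => (n.+1 * (3 * m + 1))%N%:R)); last exact: (h n).
  move=> x y /eqP; rewrite eqr_nat eqn_pmul2l // eqn_add2r eqn_pmul2l // => /eqP; exact.
by move/(congr1 (fun p : {poly rat} => p`_k)); rewrite coef_map coef0.
Qed.

Lemma gevM n u p q : gev n u (p * q) = gev n u p * gev n u q.
Proof. by rewrite /gev rmorphM hornerM. Qed.

Lemma nf0 c : (forall j i, c j i = 0) -> nf c = 0.
Proof.
by move=> h; rewrite /nf big1 // => j _; rewrite big1 // => i _; rewrite h rmorph0 !mul0r.
Qed.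

Lemma I_prime F G : F * G \in I -> (F \in I) || (G \in I).
Proof.
move=> FG; have [c hc] := red_all F; have [d hd] := red_all G.
have cd j i j' i' : c j i * d j' i' = 0.
  apply: grid_eq0 => n m; rewrite gevM.
  have hu : (3 * m + 1)%:R = 1 :> 'F_3 by rewrite natrD natrM pchar_Fp_0 // mul0r add0r.
  have [K [e [eI enf]]] := @specialization n.+1 _ isT hu.
  have eF : e F = e (nf c) by apply/eqP; rewrite -subr_eq0 -rmorphB eI.
  have eG : e G = e (nf d) by apply/eqP; rewrite -subr_eq0 -rmorphB eI.
  have /eqP := eI _ FG; rewrite rmorphM mulf_eq0 eF eG => /orP[] /eqP h.
    by rewrite (enf _ h) mul0r.
  by rewrite (enf _ h) mulr0.
case: (boolP [exists j, exists i, c j i != 0]).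
  case/existsP => j /existsP[i cji].
  move: hd; rewrite nf0 ?subr0 => [->|j' i']; first by rewrite orbT.
  by have /eqP := cd j i j' i'; rewrite mulf_eq0 (negPf cji) => /eqP.
rewrite negb_exists => /forallP h.
move: hc; rewrite nf0 ?subr0 => [-> //|j i].
by have := h j; rewrite negb_exists => /forallP/(_ i); rewrite negbK => /eqP.
Qed.

Lemma I_1 : 1 \notin I.
Proof.
have [K [e [eI _]]] := @specialization 1 1 isT erefl.
by apply/negP => /eI/eqP; rewrite rmorph1 oner_eq0.
Qed.

Lemma I_closed : idealr_closed I.
Proof. by split; [exact: I0 | exact: I_1 | move=> a u v hu hv; apply: ID => //; apply: IM]. Qed.

Lemma I_msym (s : 'S_5) F : F \in I -> msym s F \in I.
Proof.
have ps k : msym s (psum k) = psum k.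
  rewrite /psum rmorph_sum (reindex_inj (@perm_inj _ s^-1)%g) /=; apply: eq_bigr => i _.
  by rewrite rmorphXn /= /msym mmapX mmap1U permKV.
move=> /idealP[a [b [c ->]]]; apply/idealP; exists (msym s a), (msym s b), (msym s c).
by rewrite !(rmorphD, rmorphM) /= !ps.
Qed.

End BringPrime.

HB.instance Definition _ := isIdealr.Build Qx bring_ideal BringPrime.I_closed.
HB.instance Definition _ :=
  isPrimeIdealrClosed.Build Qx bring_ideal BringPrime.I_prime.

Definition bring_prime : prime_idealr Qx := PrimeIdealr.clone _ bring_ideal _.

(* Homogeneous coordinate ring of B. *)
Definition bring_ring : Type := {ideal_quot bring_prime}.
HB.instance Definition _ := GRing.ComNzRing.on bring_ring.

Definition toring (F : Qx) : bring_ring := \pi_({ideal_quot bring_prime})%qT F.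
Definition torepr (f : bring_ring) : Qx := generic_quotient.repr (f : {ideal_quot bring_prime}).

Lemma toring_zmod : zmod_morphism toring.
Proof. by move=> F G; rewrite /toring rmorphB. Qed.
Lemma toring_monoid : monoid_morphism toring.
Proof. by split=> [|F G]; rewrite /toring ?rmorph1 ?rmorphM. Qed.
HB.instance Definition _ := GRing.isZmodMorphism.Build _ _ toring toring_zmod.
HB.instance Definition _ := GRing.isMonoidMorphism.Build _ _ toring toring_monoid.

Lemma toreprK : cancel torepr toring.
Proof. by move=> f; rewrite /toring /torepr reprK. Qed.

Lemma toring_eq0 F : (toring F == 0) = (F \in bring_ideal).
Proof.
rewrite -[F in RHS]subr0 (Quotient.idealrBE bring_prime) /toring; congr (_ == _).
by rewrite -[LHS](rmorph0 toring).
Qed.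

Definition bring_unit : pred bring_ring := fun f => `[< exists g, g * f = 1 >].
Definition bring_inv (f : bring_ring) : bring_ring :=
  if pselect (exists g, g * f = 1) is left h then projT1 (cid h) else f.

Lemma bring_mulV : {in bring_unit, left_inverse 1 bring_inv *%R}.
Proof.
move=> f /asboolP h; rewrite /bring_inv.
by case: pselect => // h'; case: cid.
Qed.
Lemma bring_unitP (f g : bring_ring) : g * f = 1 -> f \in bring_unit.
Proof. by move=> h; apply/asboolP; exists g. Qed.
Lemma bring_inv_out : {in [predC bring_unit], bring_inv =1 id}.
Proof.
move=> f h; rewrite /bring_inv; case: pselect => // h'.
by case/negP: h; apply/asboolP.
Qed.
HB.instance Definition _ := GRing.ComNzRing_hasMulInverse.Build bring_ring
  bring_mulV bring_unitP bring_inv_out.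
Lemma bring_domain (f g : bring_ring) : f * g = 0 -> (f == 0) || (g == 0).
Proof. exact: (@Quotient.rquot_IdomainAxiom _ bring_prime). Qed.
HB.instance Definition _ :=
  GRing.ComUnitRing_isIntegral.Build bring_ring bring_domain.

(* Function field of the affine cone over B; Q(B) is its subfield of elements
   of degree 0. *)
Definition cone_field : fieldType := {fraction bring_ring}.

Definition tocone (F : Qx) : cone_field := FracField.tofrac (toring F).

Definition frac (F G : Qx) : cone_field := tocone F / tocone G.

Definition in_QB (f : cone_field) : Prop :=
  exists d (F G : Qx),
    [/\ F \is d.-homog, G \is d.-homog, G \notin bring_ideal & f = frac F G].

(* x_i |-> x_(s i) on the coordinate ring and on its field of fractions; see
   [act_frac]. *)
Definition act_ring (s : 'S_5) (f : bring_ring) : bring_ring :=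
  toring (msym s (torepr f)).

Definition act (s : 'S_5) (f : cone_field) : cone_field :=
  let x := generic_quotient.repr (f : {fraction bring_ring}) in
  FracField.tofrac (act_ring s \n_x) / FracField.tofrac (act_ring s \d_x).

Lemma act_toring s F : act_ring s (toring F) = toring (msym s F).
Proof.
apply/eqP; rewrite -subr_eq0 -rmorphB toring_eq0 -rmorphB.
by apply: BringPrime.I_msym; rewrite -toring_eq0 rmorphB /= toreprK subrr.
Qed.

Lemma act_ring_eq0 s f : (act_ring s f == 0) = (f == 0).
Proof.
rewrite -(toreprK f) act_toring !toring_eq0; apply/idP/idP; last exact: BringPrime.I_msym.
by move/(BringPrime.I_msym s^-1); rewrite -msymMm mulgV msym1m.
Qed.

Lemma act_ringM s f g : act_ring s (f * g) = act_ring s f * act_ring s g.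
Proof.
by rewrite -(toreprK f) -(toreprK g) -rmorphM !act_toring -rmorphM; congr toring; rewrite msymM.
Qed.

Lemma frac_numden (R : idomainType) (f : {fraction R}) :
  let x := generic_quotient.repr f in
  f = FracField.tofrac \n_x / FracField.tofrac \d_x.
Proof.
move=> x; have d0 : FracField.tofrac \d_x != 0 by rewrite tofrac_eq0 denom_ratioP.
apply: (canRL (mulfK d0)); rewrite -[f]reprK -/x; unlock FracField.tofrac.
rewrite -[LHS]FracField.pi_mul; apply/eqmodP => /=.
by rewrite FracField.equivfE /FracField.mulf !numden_Ratio ?mulr1 ?oner_neq0 ?denom_ratioP // mulrC.
Qed.

Lemma act_frac s F G : G \notin bring_ideal ->
  act s (frac F G) = frac (msym s F) (msym s G).
Proof.
rewrite -toring_eq0 => G0; rewrite /act.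
set x := generic_quotient.repr _.
have x0 : \d_x != 0 by exact: denom_ratioP.
have ex : frac F G = FracField.tofrac \n_x / FracField.tofrac \d_x.
  exact: frac_numden.
have := ex; rewrite /frac /tocone => /eqP.
rewrite eqr_div ?tofrac_eq0 // -!rmorphM tofrac_eq => /eqP e.
apply/eqP; rewrite -!act_toring eqr_div ?tofrac_eq0 ?act_ring_eq0 //.
by rewrite -!tofracM tofrac_eq -!act_ringM e.
Qed.

(* Q(B/S_5) is the fixed field of S_5 in Q(B). *)
Definition in_QB_mod_S5 (f : cone_field) : Prop :=
  in_QB f /\ forall s : 'S_5, act s f = f.

Definition const (a : rat) : cone_field := tocone a%:MP.

Definition evalQ (p : {poly rat}) (f : cone_field) : cone_field :=
  (map_poly const p).[f].

(* f lies in Q(t) *)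
Definition in_generated (t f : cone_field) : Prop :=
  exists p q : {poly rat}, evalQ q t != 0 /\ f = evalQ p t / evalQ q t.

Definition generates_QB_mod_S5 (t : cone_field) : Prop :=
  forall f, in_QB_mod_S5 f <-> in_generated t f.

(* The points of B over the algebraic closure of Q, through homogeneous
   coordinates. *)
Definition bring_point (P : 'I_5 -> algC) : Prop :=
  (exists i, P i != 0) /\ (forall k : 'I_3, \sum_(i < 5) P i ^+ k.+1 = 0).

Definition at_point (P : 'I_5 -> algC) (F : Qx) : algC := mmap ratr P F.

(* phi(P) = c, for c in P^1 = algC + {infinity}, with [None] for infinity. *)
Definition takes_value (P : 'I_5 -> algC) (phi : cone_field)
    (c : option algC) : Prop :=
  exists d (F G : Qx),
    [/\ F \is d.-homog, G \is d.-homog, G \notin bring_ideal, phi = frac F G &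
      match c with
      | Some z => at_point P G != 0 /\ at_point P F = z * at_point P G
      | None => at_point P G = 0 /\ at_point P F != 0
      end].

(* Local ring at the closed point of B (a curve over Q) below P, and its maximal
   ideal. *)
Definition local_ring (P : 'I_5 -> algC) (f : cone_field) : Prop :=
  exists z, takes_value P f (Some z).
Definition max_ideal (P : 'I_5 -> algC) (f : cone_field) : Prop :=
  takes_value P f (Some 0).

(* phi : B -> P^1, with phi(P) = c, is unramified at P: the maximal ideal of the
   local ring of P^1 (over Q) at c generates the maximal ideal of the local ring
   at P; residue fields have characteristic 0, so that separability is
   automatic.  The ideal at a finite c is principal, generated by a polynomial
   over Q vanishing at c; the one at infinity is generated by the inverse of the
   coordinate.  The other inclusion always holds. *)
Definition unramified_at (P : 'I_5 -> algC) (phi : cone_field)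
    (c : option algC) : Prop :=
  forall f, max_ideal P f ->
    exists2 g, local_ring P g &
      match c with
      | Some z => exists2 p : {poly rat}, root (map_poly ratr p) z &
          f = g * evalQ p phi
      | None => f = g * phi^-1
      end.

Definition constant_function (phi : cone_field) : Prop :=
  exists c, forall P, bring_point P -> takes_value P phi c.

Definition algebraic_belyi (phi : cone_field) : Prop :=
  [/\ in_QB phi,
      ~ constant_function phi &
      forall P, bring_point P -> exists2 c, takes_value P phi c &
        [\/ c = Some 0, c = Some 1, c = None | unramified_at P phi c]].

(* The permutations (12345) and (12); the coordinate x_k is 'X_(k - 1). *)
Definition rho : 'S_5 := perm (@ordS_inj 5).
Definition kappa : 'S_5 := tperm (inord 0) (inord 1).

Definition T_bring : cone_field :=
  frac (\prod_(i < 5 | i != ord_max) 'X_i) ('X_ord_max ^+ 4).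

Definition t_bring : cone_field :=
  \sum_(1 <= i < 6) act (rho ^+ i)%g T_bring +
  \sum_(1 <= i < 6) act kappa (act (rho ^+ i)%g T_bring).

(* Main.v *)
(* Let e_k be the elementary symmetric functions of the coordinates.  On B Newton's
   identities give e_1 = e_2 = e_3 = 0, so the x_i are the roots of X^5 + e_4 X - e_5.
   Each summand of t is e_5 / x_i^5 for some i, and summing over the roots yields
   t = 2 j + 10 with j = e_4^5 / e_5^4.

   Generation: an invariant f = F/G can be written as a quotient of symmetric
   polynomials (multiply by the conjugates of G, then average).  In the degree 0
   coordinates xi_i = x_i e_4 / e_5, the roots of X^5 + j X - j, a symmetric polynomial
   is a polynomial in j.

   Ramification: let phi = - 256/3125 j, so that phi = 1 is the vanishing of the
   discriminant 256 e_4^5 + 3125 e_5^4, and let phi(P) = z with z not in {0, 1, infinity}.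
   If F(P) = 0, some U with U(P) <> 0 makes U F vanish on the whole S_5-orbit of P.
   Writing D for the product of the x_i - x_j, i <> j, there are a_k, b_k with
   D U F = sum_k Tr(U F a_k) b_k.  The traces are polynomials in phi vanishing at z, hence
   multiples of the minimal polynomial of z over Q, and D(P) U(P) <> 0. *)
From HB Require Import structures.
Require Import Defs.
From mathcomp Require Import all_boot all_order all_algebra all_fingroup all_field.
From mathcomp Require Import boolp mpoly ring.
Import Defs.
Import Order.TTheory GRing.Theory Num.Theory.
Local Open Scope ring_scope.
Set Implicit Arguments.
Unset Strict Implicit.
Unset Printing Implicit Defensive.

(** * Symmetric functions of the roots *)

Lemma eq_mpoly_rmorphism (n : nat) (R : nzRingType) (S : comNzRingType)
    (f g : {rmorphism {mpoly R[n]} -> S}) :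
  (forall c, f c%:MP = g c%:MP) -> (forall i, f 'X_i = g 'X_i) -> f =1 g.
Proof.
move=> fgC fgX p; rewrite (mpolyE p) !rmorph_sum; apply: eq_bigr => m _.
rewrite -mul_mpolyC !rmorphM fgC mpolyXE_id !rmorph_prod; congr (_ * _).
by apply: eq_bigr => i _; rewrite !rmorphXn fgX.
Qed.

Section Msym.
Variables (n : nat) (R : nzRingType) (s : 'S_n).

Lemma msymC c : msym s c%:MP = c%:MP :> {mpoly R[n]}.
Proof. by rewrite -[c%:MP]mulr1 mul_mpolyC msymZ msym1. Qed.

Lemma msymXi i : msym s 'X_i = 'X_(s i) :> {mpoly R[n]}.
Proof. by rewrite /msym mmapX mmap1U. Qed.
End Msym.

Section Mmap.
Variables (n : nat) (R : nzRingType) (S : comNzRingType) (h : {rmorphism R -> S}).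

Lemma mmapXi (v : 'I_n -> S) i : mmap h v 'X_i = v i.
Proof. by rewrite mmapX mmap1U. Qed.

Lemma eq_mmap (v w : 'I_n -> S) : v =1 w -> mmap h v =1 mmap h w.
Proof. by move=> vw p; apply: eq_bigr => m _; rewrite (mmap1_eq _ vw). Qed.

Lemma mmap_scale (v : 'I_n -> S) c d p : p \is d.-homog ->
  mmap h (fun i => v i * c) p = mmap h v p * c ^+ d.
Proof.
move/dhomogP => hp; rewrite /mmap mulr_suml !big_seq; apply: eq_bigr => m /hp <-.
rewrite -mulrA; congr (_ * _); rewrite /mmap1 /= mdegE -prodrXr -big_split /=.
by apply: eq_bigr => i _; rewrite exprMn.
Qed.

Lemma msym_mmap (v : 'I_n -> S) (s : 'S_n) p :
  mmap h v (msym s p) = mmap h (v \o s) p.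
Proof.
pose f : {rmorphism {mpoly R[n]} -> S} := mmap h v.
apply: (@eq_mpoly_rmorphism n R S (f \o @msym n R s) (mmap h (v \o s))) => [c|i] /=.
  by rewrite msymC /f /= !mmapC.
by rewrite msymXi /f /= !mmapXi.
Qed.
End Mmap.

(** The elementary symmetric polynomials have integer coefficients, so Vieta's formula over the
    integers can be pushed through evaluation at [v], whatever [R] is. *)
Lemma mmap_Viete (R : nzRingType) (n : nat) (S : comNzRingType) (h : {rmorphism R -> S})
    (v : 'I_n -> S) :
  \prod_(i < n) ('X - (v i)%:P) =
  \sum_(k < n.+1) (-1) ^+ k *: (mmap h v (mesym n R k) *: 'X^(n - k)).
Proof.
pose f : {rmorphism {mpoly int[n]} -> S} := mmap intr v.
move: (Viete n) => /(congr1 (map_poly f)).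
rewrite rmorph_prod rmorph_sum /=.
under eq_bigr do rewrite rmorphB /= map_polyX map_polyC /= mmapXi.
move=> ->; apply: eq_bigr => k _.
rewrite !map_polyZ map_polyXn rmorph_sign; congr (_ *: (_ *: _)).
rewrite /mesym !rmorph_sum; apply: eq_bigr => A _; rewrite !rmorph_prod.
by apply: eq_bigr => i _; rewrite /f /= !mmapXi.
Qed.

Section BringQuintic.
Variables (L : fieldType) (h : {rmorphism rat -> L}) (v : 'I_5 -> L).
Hypothesis vP : forall k : 'I_3, \sum_(i < 5) v i ^+ k.+1 = 0.

Lemma rat_rmorph_natS_neq0 n : n.+1%:R != 0 :> L.
Proof. by rewrite -(rmorph_nat h) fmorph_eq0 pnatr_eq0. Qed.

(** Newton's identities up to p_4, checked on explicit expansions in five variables; [h] forces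
    characteristic 0, which permits division by 2 and 3. *)
Lemma bring_quintic :
  [/\ mmap h v (mesym 5 rat 1) = 0, mmap h v (mesym 5 rat 2) = 0, mmap h v (mesym 5 rat 3) = 0,
      \sum_(i < 5) v i ^+ 4 = - (4%:R * mmap h v (mesym 5 rat 4)) &
      \prod_(i < 5) ('X - (v i)%:P) =
        'X^5 + mmap h v (mesym 5 rat 4) *: 'X - (mmap h v (mesym 5 rat 5))%:P].
Proof.
have V := mmap_Viete h v.
have e1 := vP ord0; have e2 := vP (inord 1); have e3 := vP (inord 2).
rewrite inordK // in e2; rewrite inordK // in e3.
set P := \prod_(i < 5) _ in V *.
have Vc k : (k < 6)%N -> P`_(5 - k) = (-1) ^+ k * mmap h v (mesym 5 rat k).
  move=> hk; rewrite V coef_sum (bigD1 (Ordinal hk)) //= !coefZ coefXn eqxx mulr1.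
  rewrite big1 ?addr0 // => i ik; rewrite !coefZ coefXn.
  rewrite (_ : (_ == _) = false) ?mulr0 //; apply/negbTE; apply: contraNN ik.
  move=> /eqP ik; apply/eqP/val_inj => /=.
  have := ltn_ord i; rewrite ltnS => hi.
  by rewrite -(subKn hi) -ik subKn.
pose w k := v (inord k).
have ev (F : 'I_5 -> L) : \sum_(i < 5) F i = F (inord 0) + F (inord 1) + F (inord 2) + F (inord 3) + F (inord 4).
  by rewrite !big_ord_recr big_ord0 /= add0r; do ![congr (_ + _)]; congr F; apply/val_inj; rewrite /= inordK.
pose E1 := w 0 + w 1 + w 2 + w 3 + w 4.
pose E2 := w 0 * w 1 + w 0 * w 2 + w 0 * w 3 + w 0 * w 4 + w 1 * w 2 + w 1 * w 3 + w 1 * w 4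
  + w 2 * w 3 + w 2 * w 4 + w 3 * w 4.
pose E3 := w 0 * w 1 * w 2 + w 0 * w 1 * w 3 + w 0 * w 1 * w 4 + w 0 * w 2 * w 3
  + w 0 * w 2 * w 4 + w 0 * w 3 * w 4 + w 1 * w 2 * w 3 + w 1 * w 2 * w 4 + w 1 * w 3 * w 4
  + w 2 * w 3 * w 4.
pose E4 := w 0 * w 1 * w 2 * w 3 + w 0 * w 1 * w 2 * w 4 + w 0 * w 1 * w 3 * w 4
  + w 0 * w 2 * w 3 * w 4 + w 1 * w 2 * w 3 * w 4.
pose E5 := w 0 * w 1 * w 2 * w 3 * w 4.
have PE : P = 'X^5 - E1%:P * 'X^4 + E2%:P * 'X^3 - E3%:P * 'X^2 + E4%:P * 'X - E5%:P.
  rewrite (_ : P = ('X - (w 0)%:P) * ('X - (w 1)%:P) * ('X - (w 2)%:P) * ('X - (w 3)%:P) * ('X - (w 4)%:P)).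
    by rewrite /E1 /E2 /E3 /E4 /E5; ring.
  rewrite /P !big_ord_recr big_ord0 /= mul1r.
  by do ![congr (_ * _)]; congr ('X - (v _)%:P); apply/val_inj; rewrite /= inordK.
(* Comparing coefficients of Vieta's formula and of the expanded product identifies e_k with the
   explicit [E1] to [E5]. *)
have sE k : (k < 6)%N -> mmap h v (mesym 5 rat k) = [:: 1; E1; E2; E3; E4; E5]`_k.
  move=> hk; transitivity ((-1) ^+ k * P`_(5 - k)).
    by rewrite Vc // mulrA -expr2 sqrr_sign mul1r.
  rewrite PE !(coefD, coefB, coefN, coefCM, coefXn, coefX, coefC).
  by case: k hk => [|[|[|[|[|[|//]]]]]] _ /=; ring.
have [s1 s2 s3 s4 s5] := And5 (sE 1 isT) (sE 2 isT) (sE 3 isT) (sE 4 isT) (sE 5 isT).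
rewrite /= in s1 s2 s3 s4 s5; rewrite s1 s2 s3 s4 s5.
rewrite !ev -!/(w _) in e1 e2 e3.
have E10 : E1 = 0 by rewrite -[RHS]e1 /E1; ring.
have E20 : E2 = 0.
  (* The index is shifted by one: the factor is 2, for 2 e_2 = e_1^2 - p_2. *)
  apply: (mulfI (rat_rmorph_natS_neq0 1)); rewrite mulr0.
  rewrite (_ : _ * E2 = E1 ^+ 2 - (w 0 ^+ 2 + w 1 ^+ 2 + w 2 ^+ 2 + w 3 ^+ 2 + w 4 ^+ 2)).
    by rewrite e2 E10; ring.
  by rewrite /E1 /E2; ring.
have E30 : E3 = 0.
  apply: (mulfI (rat_rmorph_natS_neq0 2)); rewrite mulr0.
  rewrite (_ : _ * E3 = w 0 ^+ 3 + w 1 ^+ 3 + w 2 ^+ 3 + w 3 ^+ 3 + w 4 ^+ 3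
    - E1 ^+ 3 + 3%:R * E1 * E2).
    by rewrite e3 E10; ring.
  by rewrite /E1 /E2 /E3; ring.
rewrite ev -!/(w _) PE E10 E20 E30; split=> //; last by rewrite -mul_polyC; ring.
transitivity (E1 ^+ 4 - 4%:R * E1 ^+ 2 * E2 + 2%:R * E2 ^+ 2 + 4%:R * E1 * E3 - 4%:R * E4).
  by rewrite /E1 /E2 /E3 /E4; ring.
by rewrite E10 E20; ring.
Qed.
End BringQuintic.

Section BringQuinticRoots.
Variables (L : fieldType) (h : {rmorphism rat -> L}) (v : 'I_5 -> L).
Hypothesis vP : forall k : 'I_3, \sum_(i < 5) v i ^+ k.+1 = 0.
Local Notation s4 := (mmap h v (mesym 5 rat 4)).
Local Notation s5 := (mmap h v (mesym 5 rat 5)).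

Lemma bring_quintic_root i : v i ^+ 5 = s5 - s4 * v i.
Proof.
have [_ _ _ _ /(congr1 (horner^~ (v i)))] := bring_quintic h vP.
rewrite !hornerE (bigD1 i) //= !hornerE subrr mul0r => /esym e.
by apply/eqP; rewrite -subr_eq0 -e; apply/eqP; ring.
Qed.

(** A double root a of X^5 + e_4 X - e_5 also kills the derivative, so e_4 = -5 a^4 and e_5 = -4
    a^5; the two terms are then opposite multiples of a^20. *)
Lemma bring_quintic_disc i j : i != j -> v i = v j ->
  256%:R * s4 ^+ 5 + 3125%:R * s5 ^+ 4 = 0.
Proof.
move=> ij vij; have [_ _ _ _ /(congr1 (fun p : {poly L} => p^`().[v i]))] := bring_quintic h vP.
rewrite (bigD1 i) //= (bigD1 j) ?[j == _]eq_sym //= -vij.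
rewrite !derivM !(derivD, derivN, derivC, derivX, derivZ, derivXn) !hornerE /= subrr.
rewrite !(mul0r, mulr0, addr0, mulr1) => /esym e.
have e4 : s4 = - (5%:R * v i ^+ 4).
  by apply/eqP; rewrite -subr_eq0 -[X in _ == X]e; apply/eqP; ring.
have e5 : s5 = v i ^+ 5 + s4 * v i by rewrite bring_quintic_root; ring.
by rewrite e5 e4; move: (v i) => a; ring.
Qed.

(** Dividing x^5 = e_5 - e_4 x by x^(m+1) and summing over the roots gives e_5 q_(m+1) = p_(4-m) +
    e_4 q_m for the power sums [q] of the inverses. As p_1, p_2 and p_3 vanish, q_m = (e_4/e_5)^m
    for m from 1 to 4. *)
Lemma bring_sum_inv5 : s5 != 0 -> \sum_(i < 5) s5 / v i ^+ 5 = 5%:R + s4 ^+ 5 / s5 ^+ 4.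
Proof.
move=> s50; have [_ _ _ p4 _] := bring_quintic h vP.
have v0 i : v i != 0.
  apply: contraNneq s50 => vi; have := bring_quintic_root i.
  by rewrite vi expr0n mulr0 subr0 => <-.
have e1 : \sum_(i < 5) v i ^+ 1 = 0 by exact: (vP ord0).
have e2 : \sum_(i < 5) v i ^+ 2 = 0 by have := vP (inord 1); rewrite inordK.
have e3 : \sum_(i < 5) v i ^+ 3 = 0 by have := vP (inord 2); rewrite inordK.
pose q m := \sum_(i < 5) (v i)^-1 ^+ m.
have qS m : (m < 5)%N -> s5 * q m.+1 = \sum_(i < 5) v i ^+ (4 - m) + s4 * q m.
  move=> hm; rewrite /q !mulr_sumr -big_split /=; apply: eq_bigr => i _.
  have -> : s5 = v i ^+ 5 + s4 * v i by rewrite bring_quintic_root; ring.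
  by case: m hm => [|[|[|[|[|//]]]]] _ /=; field.
have q0 : q 0 = 5%:R by rewrite /q; under eq_bigr do rewrite expr0; rewrite sumr_const card_ord.
(* Here p_4 = -4 e_4 and q_0 = 5 leave a single e_4. *)
have q1 : q 1 = s4 / s5 by apply: (mulfI s50); rewrite qS // p4 q0; field.
have q2 : q 2 = (s4 / s5) ^+ 2 by apply: (mulfI s50); rewrite qS // e3 q1; field.
have q3 : q 3 = (s4 / s5) ^+ 3 by apply: (mulfI s50); rewrite qS // e2 q2; field.
have q4 : q 4 = (s4 / s5) ^+ 4 by apply: (mulfI s50); rewrite qS // e1 q3; field.
rewrite (eq_bigr (fun i => s5 * (v i)^-1 ^+ 5)) => [|i _]; last by rewrite exprVn.
rewrite -mulr_sumr -/(q 5) qS // q4; under eq_bigr do rewrite expr0.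
by rewrite sumr_const card_ord; field.
Qed.
End BringQuinticRoots.

(** By the fundamental theorem [A] is a polynomial in e_1, ..., e_5; sending e_1, e_2, e_3 to 0 and
    both e_4 and e_5 to X turns it into [q]. The same [q] serves every field, which links an
    identity in the function field to its values at points. *)
Lemma bring_symmetric (A : Qx) : A \is symmetric ->
  exists q : {poly rat}, forall (L : fieldType) (h : {rmorphism rat -> L}) v,
    (forall k : 'I_3, \sum_(i < 5) v i ^+ k.+1 = 0) ->
    mmap h v (mesym 5 rat 4) = mmap h v (mesym 5 rat 5) ->
    mmap h v A = (map_poly h q).[mmap h v (mesym 5 rat 5)].
Proof.
move=> /sym_fundamental[t [<- _]].
pose c (i : 'I_5) : {poly rat} := if (i < 3)%N then 0 else 'X.
exists (mmap (@polyC rat) c t) => L h v vP s45.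
set j := mmap h v (mesym 5 rat 5) in s45 *.
pose e := mmap h v : {rmorphism Qx -> L}.
apply: (@eq_mpoly_rmorphism 5 rat L
  (e \o comp_mpoly [tuple mesym 5 rat i.+1 | i < 5])
  (horner_eval j \o map_poly h \o mmap (@polyC rat) c)) => [a|i] /=.
  by rewrite comp_mpolyC /e /= !mmapC map_polyC /horner_eval hornerC.
rewrite comp_mpolyXU -tnth_nth tnth_mktuple mmapXi /horner_eval /e /c /=.
have [s1 s2 s3 _ _] := bring_quintic h vP.
case: i => -[|[|[|[|[|//]]]]] hi /=.
- by rewrite s1 rmorph0 horner0.
- by rewrite s2 rmorph0 horner0.
- by rewrite s3 rmorph0 horner0.
- by rewrite s45 map_polyX hornerX.
- by rewrite map_polyX hornerX.
Qed.

(** * Traces over the symmetric group *)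

Section OrbitCofactor.
Variables (gT : finGroupType) (S : comNzRingType) (L : idomainType).
Variable act : gT -> {rmorphism S -> S}.
Hypothesis act1 : act 1%g =1 id.
Hypothesis actM : forall s u, act (s * u)%g =1 act u \o act s.

(* Split the characteristic polynomial [prod_s (Y - s F)] at its lowest coefficient not
   killed by [ev], and evaluate its upper part at [F]. *)
Lemma orbit_cofactor (ev : {rmorphism S -> L}) F : ev F = 0 ->
  exists2 U, ev U != 0 & forall s, ev (act s (U * F)) = 0.
Proof.
move=> F0; pose chi : {poly S} := \prod_(s : gT) ('X - (act s F)%:P).
have chi_sym s : map_poly (act s) chi = chi.
  rewrite /chi rmorph_prod [RHS](reindex_inj (mulIg s)) /=; apply: eq_bigr => u _.
  by rewrite rmorphB /= map_polyX map_polyC /= actM.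
have chi_root s : chi.[act s F] = 0.
  by rewrite /chi horner_prod (bigD1 s) // hornerXsubC subrr [LHS]mul0r.
have ex : exists k, ev chi`_k != 0.
  exists (size chi).-1; have /monicP : chi \is monic by apply: monic_prod_XsubC.
  by rewrite lead_coefE => ->; rewrite rmorph1 oner_neq0.
case: (ex_minnP ex) => k k0 kmin.
have low : map_poly ev (take_poly k chi) = 0.
  apply/polyP => i; rewrite coef_map coef_take_poly coef0; case: ltnP => ik; last exact: rmorph0.
  by apply/eqP/negPn/negP => /kmin; rewrite leqNgt ik.
pose U := (drop_poly k chi).[F].
(* The coefficients of [chi] are invariant, so each conjugate of [U] is the same upper part,
   evaluated at the conjugate of [F]. *)
have evU s : ev (act s U) = (map_poly ev (drop_poly k chi)).[ev (act s F)].
  rewrite /U -!horner_map; congr (map_poly ev _).[_].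
  by rewrite -[in RHS](chi_sym s); apply/polyP => i; rewrite coef_map !coef_drop_poly coef_map.
exists U; first by rewrite -(act1 U) evU act1 F0 horner_coef0 coef_map coef_drop_poly add0n.
move=> s; rewrite !rmorphM /=; have [->|sF] := eqVneq (ev (act s F)) 0; first exact: mulr0.
(* Under [ev], 0 = chi(s F) is (s F)^k times the upper part at s F, and the first factor is
   nonzero. *)
have : ev chi.[act s F] = 0 by rewrite chi_root rmorph0.
rewrite -{1}(poly_take_drop k chi) -horner_map rmorphD /= low add0r rmorphM /= map_polyXn.
rewrite !hornerE -evU => /eqP; rewrite mulf_eq0 expf_eq0 (negPf sF) andbF orbF => /eqP->.
exact: mul0r.
Qed.

End OrbitCofactor.

Section SymmetricGalois.
Variables (n : nat) (R : comNzRingType).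
Local Notation A := {mpoly R[n]}.
Implicit Types (F : A) (W : 'S_n -> A).

Definition mtrace F : A := \sum_(s : 'S_n) msym s F.

Lemma mtrace_sym F : mtrace F \is symmetric.
Proof.
apply/issymP => s; rewrite /mtrace rmorph_sum /= (reindex_inj (mulIg s^-1)%g) /=.
by apply: eq_bigr => u _; rewrite -msymMm mulgKV.
Qed.

(** A tensor, the sum of the a (x) b over [r], is encoded by its images under a (x) b |-> (s a) b
    for all s; products of tensors become pointwise products. *)
Definition tensor_rep W :=
  exists r : seq (A * A), forall s, W s = \sum_(ab <- r) msym s ab.1 * ab.2.

Lemma tensor_rep_mul W W' : tensor_rep W -> tensor_rep W' ->
  tensor_rep (fun s => W s * W' s).
Proof.
move=> [r hr] [r' hr']; exists [seq (x.1 * y.1, x.2 * y.2) | x <- r, y <- r'] => s.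
rewrite hr hr' big_allpairs_dep mulr_suml; apply: eq_bigr => x _.
by rewrite mulr_sumr; apply: eq_bigr => y _; rewrite /= msymM mulrACA.
Qed.

Lemma tensor_rep_prod (I : Type) (r : seq I) (P : pred I) (W : I -> 'S_n -> A) :
  (forall i, P i -> tensor_rep (W i)) -> tensor_rep (fun s => \prod_(i <- r | P i) W i s).
Proof.
move=> h; elim: r => [|i r IH].
  by exists [:: (1, 1)] => s; rewrite big_nil big_seq1 msym1 mulr1.
have [Pi|nPi] := boolP (P i).
  have [t ht] := tensor_rep_mul (h i Pi) IH.
  by exists t => s; rewrite big_cons Pi ht.
by have [t ht] := IH; exists t => s; rewrite big_cons (negPf nPi).
Qed.

Definition mdisc : A := \prod_(i < n) \prod_(j < n | j != i) ('X_i - 'X_j).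

(* The product of the [x_i (x) 1 - 1 (x) x_j], [i != j], is killed by every nontrivial
   permutation of the first factor: it is a separability idempotent up to [mdisc]. *)
Lemma mdisc_tensor : tensor_rep (fun s => if s == 1%g then mdisc else 0).
Proof.
have [r hr] : tensor_rep (fun s => \prod_(i < n) \prod_(j < n | j != i) (msym s 'X_i - 'X_j)).
  apply: tensor_rep_prod => i _; apply: tensor_rep_prod => j _.
  by exists [:: ('X_i, 1); (1, - 'X_j)] => s; rewrite !big_cons big_nil /= msym1; ring.
exists r => s; rewrite -hr; case: eqP => [->|/eqP s1].
  by apply: eq_bigr => i _; apply: eq_bigr => j _; rewrite msym1m.
have [i si] : exists i, s i != i.
  apply/existsP; apply: contraNT s1; rewrite negb_exists => /forallP h.
  by apply/eqP/permP => i; rewrite perm1; have := h i; rewrite negbK => /eqP.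
(* The factor with j = s i becomes x_(s i) - x_(s i). *)
by rewrite (bigD1 i) //= (bigD1 (s i)) //= msymXi subrr !mul0r.
Qed.

(** When the traces are expanded, the coefficient of [msym s F] is the sum of the (s a) b, which is
    zero unless s = 1 and [mdisc] for s = 1. So [F] is recovered from traces at the price of a
    factor [mdisc]. *)
Lemma mdisc_trace : exists r : seq (A * A),
  forall F, mdisc * F = \sum_(ab <- r) mtrace (F * ab.1) * ab.2.
Proof.
have [r hr] := mdisc_tensor; exists r => F.
under eq_bigr do rewrite mulr_suml.
rewrite exchange_big /=.
rewrite (eq_bigr (fun s => msym s F * if s == 1%g then mdisc else 0)) => [|s _].
  rewrite (bigD1 1%g) //= eqxx msym1m mulrC big1 ?addr0 // => s /negPf->.
  by rewrite mulr0.
by rewrite hr mulr_sumr; apply: eq_bigr => ab _; rewrite msymM mulrA.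
Qed.

End SymmetricGalois.

(** * The function field *)

Lemma subf_div (L : fieldType) (a b c d : L) : b != 0 -> d != 0 ->
  a / b - c / d = (a * d - c * b) / (b * d).
Proof. by move=> b0 d0; rewrite -mulNr addf_div // mulNr. Qed.

Lemma tocone_zmod_morphism : zmod_morphism tocone.
Proof. by move=> F G; rewrite /tocone !rmorphB. Qed.
Lemma tocone_monoid_morphism : monoid_morphism tocone.
Proof. by split=> [|F G]; rewrite /tocone ?rmorph1 ?rmorphM. Qed.
HB.instance Definition _ :=
  GRing.isZmodMorphism.Build Qx cone_field tocone tocone_zmod_morphism.
HB.instance Definition _ :=
  GRing.isMonoidMorphism.Build Qx cone_field tocone tocone_monoid_morphism.

Lemma const_zmod_morphism : zmod_morphism const.
Proof. by move=> a b; rewrite /const !rmorphB. Qed.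
Lemma const_monoid_morphism : monoid_morphism const.
Proof. by split=> [|a b]; rewrite /const ?rmorph1 ?rmorphM. Qed.
HB.instance Definition _ :=
  GRing.isZmodMorphism.Build rat cone_field const const_zmod_morphism.
HB.instance Definition _ :=
  GRing.isMonoidMorphism.Build rat cone_field const const_monoid_morphism.

Lemma tocone_eq0 F : (tocone F == 0) = (F \in bring_ideal).
Proof. by rewrite /tocone tofrac_eq0 toring_eq0. Qed.

Lemma bring_ideal_point (L : fieldType) (h : {rmorphism rat -> L}) (v : 'I_5 -> L) F :
  (forall k : 'I_3, \sum_(i < 5) v i ^+ k.+1 = 0) ->
  F \in bring_ideal -> mmap h v F = 0.
Proof.
move=> vP /asboolP[A ->]; rewrite rmorph_sum big1 //= => k _.
rewrite rmorphM /= /psum rmorph_sum /= (eq_bigr (fun i => v i ^+ k.+1)) ?vP ?mulr0 //.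
by move=> i _; rewrite rmorphXn /= mmapXi.
Qed.

Lemma cone_fracP (f : cone_field) : exists F G, G \notin bring_ideal /\ f = frac F G.
Proof.
have := frac_numden f; set x := generic_quotient.repr _ => /= ->.
exists (torepr \n_x), (torepr \d_x); rewrite -tocone_eq0 /frac /tocone !toreprK.
by rewrite tofrac_eq0 denom_ratioP.
Qed.

Lemma msym_ideal s F : (msym s F \in bring_ideal) = (F \in bring_ideal).
Proof. by rewrite -!toring_eq0 -act_toring act_ring_eq0. Qed.

Lemma act_tocone s F : act s (tocone F) = tocone (msym s F).
Proof.
have -> : tocone F = frac F 1 by rewrite /frac rmorph1 divr1.
by rewrite act_frac ?BringPrime.I_1 // /frac !rmorph1 divr1.
Qed.

Lemma act_zmod_morphism s : zmod_morphism (act s).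
Proof.
move=> f g; have [F [G [G0 ->]]] := cone_fracP f; have [F' [G' [G0' ->]]] := cone_fracP g.
have e : frac F G - frac F' G' = frac (F * G' - F' * G) (G * G').
  by rewrite /frac !(rmorphB, rmorphM) /= subf_div ?tocone_eq0.
have GG : G * G' \notin bring_ideal by rewrite -tocone_eq0 rmorphM mulf_neq0 // tocone_eq0.
rewrite e !act_frac // /frac !(rmorphB, rmorphM) /=.
by rewrite subf_div ?tocone_eq0 ?msym_ideal.
Qed.

Lemma act_monoid_morphism s : monoid_morphism (act s).
Proof.
split=> [|f g]; first by rewrite -(rmorph1 tocone) act_tocone msym1.
have [F [G [G0 ->]]] := cone_fracP f; have [F' [G' [G0' ->]]] := cone_fracP g.
have e : frac F G * frac F' G' = frac (F * F') (G * G').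
  by rewrite /frac !rmorphM /= mulf_div.
have GG : G * G' \notin bring_ideal by rewrite -tocone_eq0 rmorphM mulf_neq0 // tocone_eq0.
by rewrite e !act_frac // /frac !rmorphM /= mulf_div.
Qed.
HB.instance Definition _ s :=
  GRing.isZmodMorphism.Build cone_field cone_field (act s) (act_zmod_morphism s).
HB.instance Definition _ s :=
  GRing.isMonoidMorphism.Build cone_field cone_field (act s) (act_monoid_morphism s).

Lemma act_const s a : act s (const a) = const a.
Proof. by rewrite /const act_tocone msymC. Qed.

(** Presents [tocone] as evaluation at the generic point, so that the results on roots of the
    quintic apply to the function field as well as to points. *)
Lemma tocone_mmap F : tocone F = mmap const (fun i => tocone 'X_i) F.
Proof.
by apply: (@eq_mpoly_rmorphism 5 rat cone_field tocone (mmap const _)) => [c|i] /=;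
  rewrite ?mmapC ?mmapXi.
Qed.

Lemma cone_psum (k : 'I_3) : \sum_(i < 5) (tocone 'X_i) ^+ k.+1 = 0.
Proof.
have : psum k.+1 \in bring_ideal.
  apply/asboolP; exists (fun i => (i == k)%:R).
  by rewrite (bigD1 k) //= eqxx mul1r big1 ?addr0 // => i /negPf->; rewrite mul0r.
rewrite -tocone_eq0 /psum rmorph_sum => /eqP; apply: etrans.
by apply: eq_bigr => i _; rewrite rmorphXn.
Qed.

(* The degree 0 coordinates [xi_i = x_i e4 / e5] are the roots of [X^5 + j X - j],
   where [j = e4^5 / e5^4]. *)
Definition e4c : cone_field := tocone (mesym 5 rat 4).
Definition e5c : cone_field := tocone (mesym 5 rat 5).
Definition jinv : cone_field := e4c ^+ 5 / e5c ^+ 4.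
Definition xi (i : 'I_5) : cone_field := tocone 'X_i * (e4c / e5c).

Section ScaledRoots.
Variables (L : fieldType) (h : {rmorphism rat -> L}) (v : 'I_5 -> L).
Hypothesis vP : forall k : 'I_3, \sum_(i < 5) v i ^+ k.+1 = 0.
Local Notation s4 := (mmap h v (mesym 5 rat 4)).
Local Notation s5 := (mmap h v (mesym 5 rat 5)).
Definition scaled_roots i : L := v i * (s4 / s5).

Lemma scaled_roots_psum (k : 'I_3) : \sum_(i < 5) scaled_roots i ^+ k.+1 = 0.
Proof.
rewrite (eq_bigr (fun i => v i ^+ k.+1 * (s4 / s5) ^+ k.+1)); last by move=> i _; rewrite exprMn.
by rewrite -mulr_suml vP mul0r.
Qed.

Lemma scaled_roots_mesym5 : s5 != 0 ->
  mmap h scaled_roots (mesym 5 rat 5) = s4 ^+ 5 / s5 ^+ 4.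
Proof.
move=> s50; rewrite (mmap_scale h _ _ (dhomog_mesym 5 rat 5)).
by rewrite expr_div_n mulrCA; congr (_ * _); rewrite [s5 ^+ 5]exprS invfM mulVKf.
Qed.

(** The factor s4 / s5 is chosen for this: e_4 scales by its fourth power and e_5 by its fifth, and
    both become s4^5 / s5^4. *)
Lemma scaled_roots_mesym4 : s5 != 0 ->
  mmap h scaled_roots (mesym 5 rat 4) = mmap h scaled_roots (mesym 5 rat 5).
Proof.
move=> s50; rewrite scaled_roots_mesym5 // (mmap_scale h _ _ (dhomog_mesym 5 rat 4)).
by rewrite expr_div_n mulrA -exprS.
Qed.
End ScaledRoots.

(** * Two points of B and the non-vanishing of e_4 and e_5 *)

Lemma mmap_mesymnn (n : nat) (R : nzRingType) (S : comNzRingType) (h : {rmorphism R -> S})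
  (v : 'I_n -> S) : mmap h v (mesym n R n) = \prod_(i < n) v i.
Proof. by rewrite mesymnnE rmorph_prod; apply: eq_bigr => i _; rewrite /= mmapXi. Qed.

(** The fifth roots of unity: their power sums of exponent 1, 2, 3 are vanishing geometric sums. *)
Lemma bring_point_roots_of_unity : exists2 P, bring_point P &
  at_point P (mesym 5 rat 5) != 0.
Proof.
have [z zP] := C_prim_root_exists (isT : (0 < 5)%N).
have z0 : z != 0 by apply/eqP => e; have /eqP := prim_expr_order zP; rewrite e expr0n eq_sym oner_eq0.
exists (fun i => z ^+ i); last first.
  by rewrite /at_point mmap_mesymnn prodf_seq_neq0; apply/allP => i _; rewrite expf_neq0.
split=> [|k]; first by exists ord0; rewrite expf_neq0.
have zk : z ^+ k.+1 - 1 != 0.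
  by rewrite subr_eq0 -(prim_order_dvd zP); case: k => -[|[|[|]]].
apply: (mulfI zk); rewrite mulr0 (eq_bigr (fun i : 'I_5 => (z ^+ k.+1) ^+ i)); last first.
  by move=> i _; rewrite -!exprM mulnC.
by rewrite -subrX1 -exprM mulnC exprM (prim_expr_order zP) expr1n subrr.
Qed.

(** The fourth roots of unity together with 0. *)
Lemma bring_point_e5_eq0 : exists2 P, bring_point P & at_point P (mesym 5 rat 5) = 0.
Proof.
pose P (i : 'I_5) : algC := [:: 1; 'i; -1; - 'i; 0]`_i.
exists P; last by rewrite /at_point mmap_mesymnn (bigD1 ord_max) //= mul0r.
split=> [|k]; first by exists ord0; rewrite oner_neq0.
have i2 : 'i * 'i = -1 :> algC by rewrite -expr2 sqrCi.
rewrite !big_ord_recr big_ord0 /P /=; case: k => -[|[|[|//]]] _ /=; move: i2.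
- by move=> _; ring.
- by move: ('i : algC) => i i2; rewrite (_ : _ + _ = 2 + 2 * (i * i)); [rewrite i2; ring | ring].
- by move=> _; ring.
Qed.

(** If e_4 and e_5 both vanished, every coordinate would satisfy x^5 = 0. *)
Lemma bring_point_e4 P : bring_point P -> at_point P (mesym 5 rat 5) = 0 ->
  at_point P (mesym 5 rat 4) != 0.
Proof.
move=> [[i Pi] PP] e5; apply: contraNneq Pi => e4.
have := @bring_quintic_root _ ratr P PP i; rewrite -!/(at_point _ _) e4 e5 mul0r subrr => /eqP.
by rewrite expf_eq0.
Qed.

Lemma e5c_neq0 : e5c != 0.
Proof.
have [P [_ PP] e5] := bring_point_roots_of_unity; rewrite tocone_eq0.
by apply: contraNN e5 => /(@bring_ideal_point _ ratr _ _ PP) e; rewrite /at_point e.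
Qed.

Lemma e4c_neq0 : e4c != 0.
Proof.
have [P BP e5] := bring_point_e5_eq0; rewrite tocone_eq0.
apply: contraNN (bring_point_e4 BP e5) => /(@bring_ideal_point _ ratr _ _ BP.2) e.
by rewrite /at_point e.
Qed.

Lemma e4c_div_e5c_neq0 : e4c / e5c != 0.
Proof. exact: mulf_neq0 e4c_neq0 (invr_neq0 e5c_neq0). Qed.

Lemma xi_psum (k : 'I_3) : \sum_(i < 5) xi i ^+ k.+1 = 0.
Proof.
rewrite -[RHS](@scaled_roots_psum _ const (fun i => tocone 'X_i) cone_psum k).
by apply: eq_bigr => i _; rewrite /scaled_roots -!tocone_mmap.
Qed.

Lemma mmap_xi F : mmap const xi F = mmap const (scaled_roots const (fun i => tocone 'X_i)) F.
Proof. by apply: eq_mmap => i; rewrite /scaled_roots -!tocone_mmap. Qed.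

Lemma xi_mesym5 : mmap const xi (mesym 5 rat 5) = jinv.
Proof.
by rewrite mmap_xi scaled_roots_mesym5 -!tocone_mmap // e5c_neq0.
Qed.

Lemma xi_mesym4 : mmap const xi (mesym 5 rat 4) = mmap const xi (mesym 5 rat 5).
Proof. by rewrite !mmap_xi scaled_roots_mesym4 // -tocone_mmap e5c_neq0. Qed.

Lemma mmap_xi_homog d F : F \is d.-homog ->
  mmap const xi F = tocone F * (e4c / e5c) ^+ d.
Proof. by move=> dF; rewrite (mmap_scale _ _ _ dF) -tocone_mmap. Qed.

Lemma mmap_xi_neq0 d F : F \is d.-homog -> F \notin bring_ideal -> mmap const xi F != 0.
Proof.
move=> dF F0; rewrite (mmap_xi_homog dF).
by apply: mulf_neq0; [rewrite tocone_eq0 | apply: expf_neq0 e4c_div_e5c_neq0].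
Qed.

Lemma frac_mmap_xi d F G : F \is d.-homog -> G \is d.-homog ->
  frac F G = mmap const xi F / mmap const xi G.
Proof.
move=> dF dG; rewrite (mmap_xi_homog dF) (mmap_xi_homog dG) -mulf_div.
by rewrite (divff (expf_neq0 d e4c_div_e5c_neq0)) mulr1.
Qed.

Lemma act_mmap_xi s F : act s (mmap const xi F) = mmap const xi (msym s F).
Proof.
rewrite msym_mmap.
have actf : act s e4c = e4c /\ act s e5c = e5c.
  by rewrite !act_tocone !(issymP _ (mesym_sym _ _ _)).
apply: (@eq_mpoly_rmorphism 5 rat cone_field (act s \o mmap const xi) (mmap const (xi \o s))).
  by move=> c /=; rewrite !mmapC act_const.
by move=> i /=; rewrite !mmapXi /xi rmorphM fmorph_div /= actf.1 actf.2 act_tocone msymXi.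
Qed.

Lemma bring_symmetric_xi A : A \is symmetric ->
  exists q : {poly rat}, mmap const xi A = evalQ q jinv /\
    forall P, bring_point P -> at_point P (mesym 5 rat 5) != 0 ->
      mmap ratr (scaled_roots ratr P) A =
      (map_poly ratr q).[at_point P (mesym 5 rat 4) ^+ 5 / at_point P (mesym 5 rat 5) ^+ 4].
Proof.
move=> /bring_symmetric[q hq]; exists q; split=> [|P [_ PP] e5].
  by rewrite (hq _ _ _ xi_psum xi_mesym4) xi_mesym5.
rewrite (hq _ _ _ (@scaled_roots_psum _ ratr P PP)) ?scaled_roots_mesym4 //.
by rewrite scaled_roots_mesym5.
Qed.

(** Indices start at 0, so [ord_max] is 4 and rho^i sends it to 4 + i mod 5, which is i - 1 for i
    from 1 to 5: every index occurs once. *)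
Lemma act_rho_sum (V : nmodType) (F : 'I_5 -> V) :
  \sum_(1 <= i < 6) F ((rho ^+ i)%g ord_max) = \sum_(i < 5) F i.
Proof.
have rhoE k (i : 'I_5) : ((rho ^+ k)%g i = (i + k) %% 5 :> nat)%N.
  elim: k => [|k IH]; first by rewrite perm1 addn0 modn_small.
  by rewrite expgSr permM permE /= IH -addn1 modnDml addn1 addnS.
rewrite (big_addn 0 6 1) big_mkord; apply: eq_bigr => i _; congr F; apply/val_inj.
by rewrite [LHS]rhoE /= addn1 addnS -addSn modnDl modn_small.
Qed.

Lemma tocone_X_neq0 i : tocone 'X_i != 0.
Proof.
have [P [_ PP] e5] := bring_point_roots_of_unity; rewrite tocone_eq0.
apply: contraNN e5 => /(@bring_ideal_point _ ratr _ _ PP); rewrite mmapXi => Pi.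
by rewrite /at_point mmap_mesymnn (bigD1 i) //= Pi mul0r.
Qed.

Lemma T_bringE : T_bring = e5c / tocone 'X_ord_max ^+ 5.
Proof.
have e : mesym 5 rat 5 = 'X_ord_max * \prod_(i < 5 | i != ord_max) 'X_i.
  by rewrite mesymnnE (bigD1 ord_max).
rewrite /T_bring /frac /e5c e rmorphXn rmorphM /=.
by rewrite [_ ^+ 5]exprS -mulf_div (divff (tocone_X_neq0 ord_max)) mul1r.
Qed.

Lemma act_inv5 s i : act s (e5c / tocone 'X_i ^+ 5) = e5c / tocone 'X_(s i) ^+ 5.
Proof.
rewrite fmorph_div rmorphXn /= act_tocone msymXi /e5c act_tocone.
by rewrite (issymP _ (mesym_sym _ _ _)).
Qed.

Lemma t_bringE : t_bring = const 2%:R * jinv + const 10%:R.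
Proof.
have S : \sum_(i < 5) e5c / tocone 'X_i ^+ 5 = 5%:R + jinv.
  have := @bring_sum_inv5 _ const (fun i => tocone 'X_i) cone_psum.
  rewrite -!tocone_mmap => ->; first by [].
  exact: e5c_neq0.
rewrite /t_bring; under eq_bigr do rewrite T_bringE act_inv5.
under [X in _ + X]eq_bigr do rewrite T_bringE !act_inv5.
rewrite (act_rho_sum (fun i => e5c / tocone 'X_i ^+ 5)).
rewrite (act_rho_sum (fun i => e5c / tocone 'X_(kappa i) ^+ 5)).
(* [kappa] only permutes the summands, so the second sum equals the first. *)
rewrite (_ : \sum_(i < 5) e5c / tocone 'X_(kappa i) ^+ 5 = 5%:R + jinv); last first.
  by rewrite -S [RHS](reindex_perm kappa).
rewrite S !rmorph_nat.
have dbl (K : comPzRingType) (j : K) : (5%:R + j) + (5%:R + j) = 2%:R * j + 10%:R by ring.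
exact: dbl.
Qed.

Section PolynomialClosure.
Variables (Q : cone_field -> Prop).
Hypotheses (QC : forall a, Q (const a)) (QD : forall f g, Q f -> Q g -> Q (f + g)).
Hypothesis QM : forall f g, Q f -> Q g -> Q (f * g).

Lemma evalQ_closed p f : Q f -> Q (evalQ p f).
Proof.
move=> Qf; rewrite /evalQ; elim/poly_ind: p => [|p c IH].
  by rewrite rmorph0 horner0 -(rmorph0 const).
rewrite rmorphD rmorphM /= map_polyX map_polyC hornerD hornerC hornerMX.
by apply: QD => //; apply: QM.
Qed.
End PolynomialClosure.

(** Needed because [takes_value] is a relation and not a morphism: its compatibility with sums and
    products is lifted to arbitrary polynomials. *)
Lemma mmap_rel (n : nat) (R : nzRingType) (S T : comNzRingType)
    (h : {rmorphism R -> S}) (h' : {rmorphism R -> T}) v v' (Q : S -> T -> Prop) (p : {mpoly R[n]}) :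
  (forall a, Q (h a) (h' a)) ->
  (forall x y x' y', Q x x' -> Q y y' -> Q (x + y) (x' + y')) ->
  (forall x y x' y', Q x x' -> Q y y' -> Q (x * y) (x' * y')) ->
  (forall i, Q (v i) (v' i)) -> Q (mmap h v p) (mmap h' v' p).
Proof.
move=> QC QD QM Qv; rewrite /mmap; elim: (msupp p) => [|m r IH].
  by rewrite !big_nil -(rmorph0 h) -(rmorph0 h').
rewrite !big_cons; apply: (QD) => //; apply: (QM) => //; rewrite /mmap1.
elim: (index_enum _) => [|i s IHs]; first by rewrite !big_nil -(rmorph1 h) -(rmorph1 h').
rewrite !big_cons; apply: (QM) => //; elim: (m i) => [|k IHk].
  by rewrite !expr0 -(rmorph1 h) -(rmorph1 h').
by rewrite !exprS; apply: (QM).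
Qed.

Lemma frac_mul F G F' G' : frac F G * frac F' G' = frac (F * F') (G * G').
Proof. by rewrite /frac !rmorphM /= mulf_div. Qed.

Lemma frac_add F G F' G' : G \notin bring_ideal -> G' \notin bring_ideal ->
  frac F G + frac F' G' = frac (F * G' + F' * G) (G * G').
Proof. by move=> G0 G0'; rewrite /frac addf_div ?tocone_eq0 // rmorphD !rmorphM. Qed.

Lemma bring_idealM F G : F \notin bring_ideal -> G \notin bring_ideal ->
  F * G \notin bring_ideal.
Proof. by rewrite -!tocone_eq0 rmorphM; apply: mulf_neq0. Qed.

Lemma const_frac a : const a = frac a%:MP 1.
Proof. by rewrite /frac rmorph1 divr1. Qed.

Lemma dhomogC a : (a%:MP : Qx) \is 0.-homog.
Proof. by rewrite -[a%:MP]mulr1 mul_mpolyC; apply: dhomogZ; apply: dhomog1. Qed.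

Lemma in_QB_const a : in_QB (const a).
Proof.
by exists 0%N, a%:MP, 1; rewrite const_frac dhomogC dhomog1 BringPrime.I_1.
Qed.

Lemma in_QB_add f g : in_QB f -> in_QB g -> in_QB (f + g).
Proof.
move=> [d [F [G [dF dG G0 ->]]]] [d' [F' [G' [dF' dG' G0' ->]]]].
exists (d + d')%N, (F * G' + F' * G), (G * G'); split; last exact: frac_add.
- by apply: rpredD; [|rewrite addnC]; apply: dhomogM.
- exact: dhomogM.
- exact: bring_idealM.
Qed.

Lemma in_QB_mul f g : in_QB f -> in_QB g -> in_QB (f * g).
Proof.
move=> [d [F [G [dF dG G0 ->]]]] [d' [F' [G' [dF' dG' G0' ->]]]].
exists (d + d')%N, (F * F'), (G * G'); split; last exact: frac_mul.
- exact: dhomogM.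
- exact: dhomogM.
- exact: bring_idealM.
Qed.

Lemma in_QB_inv f : in_QB f -> in_QB f^-1.
Proof.
move=> [d [F [G [dF dG G0 ->]]]]; have [F0|F0] := boolP (F \in bring_ideal).
  (* By convention the inverse of 0 is 0, which lies in Q(B). *)
  have /eqP -> : (frac F G)^-1 == 0 by rewrite invr_eq0 mulf_eq0 tocone_eq0 F0.
  by rewrite -(rmorph0 const); apply: in_QB_const.
by exists d, G, F; split=> //; rewrite /frac invf_div.
Qed.

(** * Values of functions at a point of B *)

Section ValuesAtPoint.
Variables (P : 'I_5 -> algC) (BP : bring_point P).

Lemma at_point_ideal F : at_point P F != 0 -> F \notin bring_ideal.
Proof. by apply: contraNN => /(@bring_ideal_point _ ratr _ _ BP.2) e; rewrite /at_point e. Qed.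

Lemma takes_value_const a : takes_value P (const a) (Some (ratr a)).
Proof.
exists 0%N, a%:MP, 1; rewrite const_frac dhomogC dhomog1 BringPrime.I_1 /at_point.
by split=> //; rewrite rmorph1 mulr1 mmapC oner_neq0.
Qed.

Lemma takes_value_add f g a b : takes_value P f (Some a) -> takes_value P g (Some b) ->
  takes_value P (f + g) (Some (a + b)).
Proof.
move=> [d [F [G [dF dG G0 -> [Gn vF]]]]] [d' [F' [G' [dF' dG' G0' -> [Gn' vF']]]]].
exists (d + d')%N, (F * G' + F' * G), (G * G'); split; [|exact: dhomogM|exact: bring_idealM|exact: frac_add|].
  by apply: rpredD; [|rewrite addnC]; apply: dhomogM.
rewrite /at_point in Gn Gn' vF vF' *; rewrite rmorphD !rmorphM /= vF vF' mulf_neq0 //.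
by split=> //; ring.
Qed.

Lemma takes_value_mul f g a b : takes_value P f (Some a) -> takes_value P g (Some b) ->
  takes_value P (f * g) (Some (a * b)).
Proof.
move=> [d [F [G [dF dG G0 -> [Gn vF]]]]] [d' [F' [G' [dF' dG' G0' -> [Gn' vF']]]]].
exists (d + d')%N, (F * F'), (G * G'); split; [exact: dhomogM|exact: dhomogM|exact: bring_idealM|exact: frac_mul|].
rewrite /at_point in Gn Gn' vF vF' *; rewrite !rmorphM /= vF vF' mulf_neq0 //.
by split=> //; ring.
Qed.

Lemma takes_value_inv f a : a != 0 -> takes_value P f (Some a) ->
  takes_value P f^-1 (Some a^-1).
Proof.
move=> a0 [d [F [G [dF dG G0 -> [Gn vF]]]]].
have Fn : at_point P F != 0 by rewrite vF mulf_neq0.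
exists d, G, F; split=> //; [exact: at_point_ideal | by rewrite /frac invf_div |].
by split=> //; rewrite vF mulKf.
Qed.

Lemma takes_value_neq0 f a : a != 0 -> takes_value P f (Some a) -> f != 0.
Proof.
move=> a0 [d [F [G [dF dG G0 -> [Gn vF]]]]].
by apply: mulf_neq0; rewrite ?invr_eq0 tocone_eq0 // at_point_ideal // vF mulf_neq0.
Qed.

(** Cross-multiplying two presentations gives F G' = F' G on B; at [P] the right side vanishes and
    the left side does not. *)
Lemma takes_infinite_value f a : takes_value P f None -> ~ takes_value P f (Some a).
Proof.
move=> [d [F [G [_ _ G0 e [Gn Fn]]]]] [d' [F' [G' [_ _ G0' e' [Gn' Fn']]]]].
have /eqP : frac F G = frac F' G' by rewrite -e.
rewrite /frac eqr_div ?tocone_eq0 // -!rmorphM /= -subr_eq0 -rmorphB tocone_eq0.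
move=> /(@bring_ideal_point _ ratr _ _ BP.2); rewrite rmorphB !rmorphM /= -!/(at_point _ _).
by rewrite Gn mulr0 subr0 => /eqP; rewrite mulf_eq0 (negPf Fn) (negPf Gn').
Qed.

Lemma local_ring_const a : local_ring P (const a).
Proof. by exists (ratr a); apply: takes_value_const. Qed.
Lemma local_ring_add f g : local_ring P f -> local_ring P g -> local_ring P (f + g).
Proof. by move=> [a fa] [b gb]; exists (a + b); apply: takes_value_add. Qed.
Lemma local_ring_mul f g : local_ring P f -> local_ring P g -> local_ring P (f * g).
Proof. by move=> [a fa] [b gb]; exists (a * b); apply: takes_value_mul. Qed.

Lemma takes_value_mmap_xi F : at_point P (mesym 5 rat 5) != 0 ->
  takes_value P (mmap const xi F) (Some (mmap ratr (scaled_roots ratr P) F)).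
Proof.
move=> e5.
apply: (mmap_rel (Q := fun f a => takes_value P f (Some a))) => [a|||i].
- exact: takes_value_const.
- exact: takes_value_add.
- exact: takes_value_mul.
exists 5%N, ('X_i * mesym 5 rat 4), (mesym 5 rat 5).
have dX : 'X_i \is [in rat[5], 1.-homog] by rewrite dhomogX /= mdeg1.
split; [exact: (dhomogM dX (dhomog_mesym _ _ 4)) | exact: dhomog_mesym | exact: at_point_ideal | |].
  by rewrite /xi /frac rmorphM mulrA.
split=> //; rewrite /at_point rmorphM /= mmapXi /scaled_roots -!/(at_point _ _) -mulrA divfK //.
Qed.
End ValuesAtPoint.

(** * Generation and ramification *)

Lemma evalQ_comp p q f : evalQ (p \Po q) f = evalQ p (evalQ q f).
Proof. by rewrite /evalQ map_comp_poly horner_comp. Qed.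

Lemma evalQM p q f : evalQ (p * q) f = evalQ p f * evalQ q f.
Proof. by rewrite /evalQ rmorphM hornerM. Qed.

Lemma evalQ_affine a b f : evalQ (a *: 'X + b%:P) f = const a * f + const b.
Proof. by rewrite /evalQ rmorphD /= map_polyZ map_polyX map_polyC hornerD hornerZ hornerX hornerC. Qed.

Lemma jinv_t_bring : jinv = evalQ (2%:R^-1 *: 'X + (- 5%:R)%:P) t_bring.
Proof.
rewrite evalQ_affine t_bringE mulrDr mulrA -!rmorphM mulVf // rmorph1 mul1r -addrA -rmorphD.
by rewrite (_ : _ + _ = 0) ?rmorph0 ?addr0.
Qed.

Lemma act_t_bring s : act s t_bring = t_bring.
Proof.
have acte k : act s (tocone (mesym 5 rat k)) = tocone (mesym 5 rat k).
  by rewrite act_tocone (issymP _ (mesym_sym _ _ _)).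
by rewrite t_bringE rmorphD rmorphM fmorph_div !rmorphXn /= !acte !act_const.
Qed.

Lemma in_QB_jinv : in_QB jinv.
Proof.
exists 20%N, (mesym 5 rat 4 ^+ 5), (mesym 5 rat 5 ^+ 4); split.
- exact: (dhomogMn 5 (dhomog_mesym 5 rat 4)).
- exact: (dhomogMn 4 (dhomog_mesym 5 rat 5)).
- by rewrite -tocone_eq0 rmorphXn expf_neq0 // e5c_neq0.
- by rewrite /frac !rmorphXn.
Qed.

Lemma in_QB_t_bring : in_QB t_bring.
Proof.
rewrite t_bringE; apply: in_QB_add; last exact: in_QB_const.
by apply: in_QB_mul; [exact: in_QB_const | exact: in_QB_jinv].
Qed.

Lemma generated_in_QB_mod_S5 f : in_generated t_bring f -> in_QB_mod_S5 f.
Proof.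
have Q p : in_QB (evalQ p t_bring).
  apply: evalQ_closed; [exact: in_QB_const|exact: in_QB_add|exact: in_QB_mul|exact: in_QB_t_bring].
have A s p : act s (evalQ p t_bring) = evalQ p t_bring.
  apply: (evalQ_closed (Q := fun f => act s f = f)) => [a|x y ex ey|x y ex ey|].
  - exact: act_const.
  - by rewrite rmorphD /= ex ey.
  - by rewrite rmorphM /= ex ey.
  - exact: act_t_bring.
move=> [p [q [q0 ->]]]; split=> [|s]; first by apply: in_QB_mul => //; apply: in_QB_inv.
by rewrite fmorph_div /= !A.
Qed.

Lemma QB_mod_S5_in_generated f : in_QB_mod_S5 f -> in_generated t_bring f.
Proof.
move=> [[d [F [G [dF dG G0 ef]]]] fs].
(* F/G = FH/N, where the norm N of G is symmetric. *)
pose H := \prod_(s : 'S_5 | s != 1%g) msym s G.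
pose N := \prod_(s : 'S_5) msym s G.
have NE : N = G * H by rewrite /N (bigD1 1%g) //= msym1m.
have Nsym : N \is symmetric.
  apply/issymP => s; rewrite /N rmorph_prod [RHS](reindex_inj (mulIg s)) /=.
  by apply: eq_bigr => u _; rewrite msymMm.
pose E := mmap const xi : {rmorphism Qx -> cone_field}.
have EG0 : E G != 0 by exact: mmap_xi_neq0 dG G0.
have EN0 : E N != 0.
  rewrite /N rmorph_prod; apply/prodf_neq0 => s _.
  by rewrite /E /= -act_mmap_xi fmorph_eq0.
have fN : f * E N = E (F * H).
  by rewrite ef (frac_mmap_xi dF dG) NE (rmorphM E G H) (rmorphM E F H) mulrA (divfK EG0).
(* Invariance of [f] makes FH symmetric only after [E]; summing over the group replaces it by a
   trace, a genuinely symmetric polynomial. *)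
have trN : f * E (#|'S_5|%:R * N) = E (mtrace (F * H)).
  rewrite /mtrace rmorph_sum /= (eq_bigr (fun _ => f * E N)) => [|s _].
    by rewrite sumr_const rmorphM rmorph_nat mulrCA mulr_natl.
  rewrite -act_mmap_xi -[mmap const xi _]fN rmorphM /= fs; congr (_ * _).
  by rewrite /E /= act_mmap_xi (issymP _ Nsym).
have nN : #|'S_5|%:R * N \is symmetric.
  by apply/issymP => s; rewrite msymM rmorph_nat (issymP _ Nsym).
have [p [ep _]] := bring_symmetric_xi (mtrace_sym (F * H)).
have [q [eq _]] := bring_symmetric_xi nN.
have q0 : evalQ q jinv != 0.
  rewrite -eq -[mmap const xi _]/(E _) (rmorphM E _ N) (rmorph_nat E).
  apply: mulf_neq0; last exact: EN0.
  by rewrite -(rmorph_nat const) fmorph_eq0 pnatr_eq0 -lt0n; apply/card_gt0P; exists 1%g.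
pose l : {poly rat} := 2%:R^-1 *: 'X + (- 5%:R)%:P.
exists (p \Po l), (q \Po l); rewrite !evalQ_comp -jinv_t_bring; split=> //.
by apply: (canRL (mulfK q0)); rewrite -eq -ep; exact: trN.
Qed.

(** * Unramifiedness outside 0, 1 and infinity *)

Section Unramified.
Variables (P : 'I_5 -> algC) (BP : bring_point P).
Let e4 := at_point P (mesym 5 rat 4).
Let e5 := at_point P (mesym 5 rat 5).
Hypotheses (e40 : e4 != 0) (e50 : e5 != 0).
Let J := e4 ^+ 5 / e5 ^+ 4.
Hypothesis J_disc : 256%:R * J + 3125%:R != 0.
Let ev : {rmorphism Qx -> algC} := mmap ratr (scaled_roots ratr P).

(** For the scaled roots e_4 = e_5 = J, so a coincidence would give J^4 (256 J + 3125) = 0. *)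
Lemma scaled_roots_mdisc : ev (mdisc 5 rat) != 0.
Proof.
rewrite /mdisc rmorph_prod; apply/prodf_neq0 => i _.
rewrite rmorph_prod; apply/prodf_neq0 => j ji.
rewrite rmorphB /ev /= !mmapXi subr_eq0; apply: contraNneq J_disc => vij.
have PP := BP.2; have S := @scaled_roots_psum _ ratr P PP.
have := @bring_quintic_disc _ ratr _ S i j; rewrite eq_sym => /(_ ji vij).
rewrite scaled_roots_mesym4 // scaled_roots_mesym5 // -!/(at_point _ _) -/e4 -/e5 -/J.
have -> : 256%:R * J ^+ 5 + 3125%:R * J ^+ 4 = J ^+ 4 * (256%:R * J + 3125%:R).
  by move: J => x; ring.
move/eqP; rewrite mulf_eq0 expf_eq0 /= => /orP[|//].
by rewrite /J mulf_eq0 invr_eq0 !expf_eq0 /= (negPf e40) (negPf e50).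
Qed.

Lemma bring_unramified phi c : c != 0 -> phi = const c * jinv ->
  unramified_at P phi (Some (ratr c * J)).
Proof.
move=> c0 ephi f [d [F [G [dF dG G0 -> [Gn vF]]]]].
rewrite mul0r in vF.
pose E := mmap const xi : {rmorphism Qx -> cone_field}.
have Eval A : takes_value P (E A) (Some (ev A)) by exact: takes_value_mmap_xi.
have Eneq0 A : ev A != 0 -> E A != 0 by move=> h; apply: (takes_value_neq0 BP h).
have evF : ev F = 0 by rewrite /ev /= (mmap_scale _ _ _ dF) -!/(at_point _ _) vF mul0r.
have evG : ev G != 0.
  rewrite /ev /= (mmap_scale _ _ _ dG) mulf_neq0 // expf_neq0 // mulf_neq0 ?invr_eq0 //.
pose a (s : 'S_5) : {rmorphism Qx -> Qx} := @msym 5 rat s.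
have [U evU evUF] := @orbit_cofactor _ _ _ a (@msym1m 5 rat) (fun s u A => msymMm A s u) ev F evF.
have [r hr] := mdisc_trace 5 rat.
(* [p] is the minimal polynomial over Q of the value of [phi] at [P]. *)
have [p [_ _] pmin] := minCpolyP (ratr c * J).
have proot : root (map_poly ratr p) (ratr c * J) by rewrite pmin dvdpp.
have cj : jinv = evalQ (c^-1 *: 'X + 0%:P) phi.
  by rewrite evalQ_affine rmorph0 addr0 ephi mulrA -rmorphM mulVf // rmorph1 mul1r.
have phil : local_ring P phi.
  rewrite ephi -xi_mesym5; apply: local_ring_mul; first exact: local_ring_const.
  by eexists; apply: Eval.
(* The trace is a polynomial in [phi] over Q. Its value at [P] is a sum over the orbit in which each
   term contains a conjugate of U F, hence vanishes; so [p] divides it. *)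
have tr A : exists2 g, local_ring P g & E (mtrace (U * F * A)) = g * evalQ p phi.
  have [q [Eq evq]] := bring_symmetric_xi (mtrace_sym (U * F * A)).
  have q0 : root (map_poly ratr (q \Po (c^-1 *: 'X + 0%:P))) (ratr c * J).
    rewrite /root map_comp_poly horner_comp rmorphD /= map_polyZ map_polyX map_polyC /=.
    rewrite hornerD hornerZ hornerX hornerC rmorph0 addr0 mulrA -rmorphM mulVf // rmorph1 mul1r.
    rewrite -evq // /mtrace rmorph_sum big1 //= => s _.
    by rewrite msymM [X in X = _](rmorphM ev) (evUF s) mul0r.
  rewrite pmin in q0; exists (evalQ ((q \Po (c^-1 *: 'X + 0%:P)) %/ p) phi).
    apply: evalQ_closed => //; [exact: local_ring_const|exact: local_ring_add|exact: local_ring_mul].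
  by rewrite -evalQM divpK // evalQ_comp -cj.
have [g1 g1l eg1] : exists2 g, local_ring P g & E (mdisc 5 rat * (U * F)) = g * evalQ p phi.
  rewrite hr rmorph_sum; elim: r {hr} => [|ab r [g gl eg]].
    by exists (const 0); [exact: local_ring_const | rewrite big_nil rmorph0 mul0r].
  have [h hl eh] := tr ab.1.
  exists (h * E ab.2 + g); last by rewrite big_cons eg rmorphM /= [mmap _ _ (mtrace _)]eh mulrDl mulrAC.
  by apply: local_ring_add => //; apply: local_ring_mul => //; eexists; apply: Eval.
(* [D] does not vanish at [P], so dividing by it stays in the local ring, and F/G is [mdisc] U F
   over [D]. *)
pose D := mdisc 5 rat * (U * G).
have evD : ev D != 0 by rewrite !rmorphM !mulf_neq0 // scaled_roots_mdisc.
exists (g1 * (E D)^-1).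
  by apply: local_ring_mul => //; eexists; apply: takes_value_inv; [exact: BP | exact: evD | exact: Eval].
exists p => //; rewrite mulrAC -eg1 /D !(rmorphM E) (frac_mmap_xi dF dG).
have key (K : fieldType) (x y z w : K) : x != 0 -> y != 0 -> w != 0 ->
    z / w = x * (y * z) / (x * (y * w)).
  by move=> x0 y0 w0; field; rewrite x0 y0 w0.
by apply: key; apply: Eneq0 => //; exact: scaled_roots_mdisc.
Qed.
End Unramified.

(** * The Belyi function *)

Section ValuesOfJ.
Variables (P : 'I_5 -> algC) (BP : bring_point P).

Lemma takes_value_jinv : at_point P (mesym 5 rat 5) != 0 ->
  takes_value P jinv (Some (at_point P (mesym 5 rat 4) ^+ 5 / at_point P (mesym 5 rat 5) ^+ 4)).
Proof.
move=> e5; have := takes_value_mmap_xi BP (mesym 5 rat 5) e5.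
by rewrite xi_mesym5 scaled_roots_mesym5.
Qed.

Lemma takes_infinite_value_jinv c : c != 0 -> at_point P (mesym 5 rat 5) = 0 ->
  takes_value P (const c * jinv) None.
Proof.
move=> c0 e5; have e4 := bring_point_e4 BP e5.
exists 20%N, (c%:MP * mesym 5 rat 4 ^+ 5), (mesym 5 rat 5 ^+ 4); split.
- exact: (dhomogM (dhomogC c) (dhomogMn 5 (dhomog_mesym 5 rat 4))).
- exact: (dhomogMn 4 (dhomog_mesym 5 rat 5)).
- by rewrite -tocone_eq0 rmorphXn expf_neq0 // e5c_neq0.
- by rewrite /jinv /frac (rmorphM tocone c%:MP) !rmorphXn mulrA.
- rewrite /at_point in e4 e5 *; split; first by rewrite rmorphXn /= e5 expr0n.
  by rewrite rmorphM rmorphXn /= mmapC mulf_neq0 ?fmorph_eq0 // expf_neq0.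
Qed.
End ValuesOfJ.

Definition opp_ratio (m n : nat) : rat := - (m%:R / n%:R).

Lemma opp_ratio_neq0 m n : m != 0%N -> n != 0%N -> opp_ratio m n != 0.
Proof.
by move=> m0 n0; rewrite oppr_eq0 mulf_eq0 invr_eq0 !pnatr_eq0 (negPf m0) (negPf n0).
Qed.

Lemma opp_ratio_mul (K : numFieldType) (m n : nat) (x : K) : n != 0%N ->
  m%:R * x + n%:R = 0 -> ratr (opp_ratio m n) * x = 1.
Proof.
move=> n0 /eqP; rewrite addr_eq0 => /eqP e.
rewrite /opp_ratio rmorphN fmorph_div !rmorph_nat.
by rewrite mulNr mulrAC e mulNr opprK divff // pnatr_eq0.
Qed.

(** This is j = t/2 - 5, multiplied by c. *)
Lemma const_t_bring c : const (c / 2%:R) * t_bring + const (- (5%:R * c)) = const c * jinv.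
Proof.
rewrite t_bringE mulrDr mulrA -!rmorphM -addrA -rmorphD divfK //.
rewrite (_ : _ + _ = 0) ?rmorph0 ?addr0 //.
by field.
Qed.

(* Chosen so that the zeros of [256 e4^5 + 3125 e5^4] lie over 1. *)
Definition belyi_scale := opp_ratio 256 3125.

Lemma algebraic_belyi_jinv : algebraic_belyi (const belyi_scale * jinv).
Proof.
have c0 : belyi_scale != 0 := opp_ratio_neq0 (isT : 256 != 0)%N (isT : 3125 != 0)%N.
split=> [||P BP].
- by apply: in_QB_mul; [exact: in_QB_const | exact: in_QB_jinv].
- move=> [c hc].
  (* The function is infinite at the first point and finite at the second. *)
  have [P BP e5] := bring_point_e5_eq0; have [P' BP' e5'] := bring_point_roots_of_unity.
  have fin := takes_value_mul (takes_value_const P' belyi_scale) (takes_value_jinv BP' e5').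
  have inf := takes_infinite_value_jinv BP c0 e5.
  case: c hc => [z|] hc; first exact: (@takes_infinite_value _ BP _ z inf (hc P BP)).
  exact: (@takes_infinite_value _ BP' _ _ (hc P' BP') fin).
have [e5|e5] := eqVneq (at_point P (mesym 5 rat 5)) 0.
  by exists None; [exact: takes_infinite_value_jinv | apply: Or43].
pose J := at_point P (mesym 5 rat 4) ^+ 5 / at_point P (mesym 5 rat 5) ^+ 4.
exists (Some (ratr belyi_scale * J)).
  exact: takes_value_mul (takes_value_const P belyi_scale) (takes_value_jinv BP e5).
(* e_4 = 0 gives the value 0, a vanishing discriminant the value 1; elsewhere the function is
   unramified. *)
have [e40|e40] := eqVneq (at_point P (mesym 5 rat 4)) 0.
  by apply: Or41; rewrite /J e40 expr0n mul0r mulr0.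
have [disc|disc] := eqVneq (256%:R * J + 3125%:R) 0; last first.
  by apply: Or44; exact: (bring_unramified BP e40 e5 disc c0 erefl).
by apply: Or42; rewrite /belyi_scale (opp_ratio_mul (isT : 3125 != 0)%N disc).
Qed.

Theorem theorem3p1 :
  generates_QB_mod_S5 t_bring /\
  (exists a b : rat, a != 0 /\ algebraic_belyi (const a * t_bring + const b)).
Proof.
split=> [f|]; first by split; [exact: QB_mod_S5_in_generated | exact: generated_in_QB_mod_S5].
exists (belyi_scale / 2%:R), (- (5%:R * belyi_scale)); split.
  by apply: mulf_neq0; first exact: (opp_ratio_neq0 (isT : 256 != 0)%N (isT : 3125 != 0)%N).
by rewrite const_t_bring; exact: algebraic_belyi_jinv.
Qed.
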